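(* Let $\mathcal V,\mathcal W\subset\mathcal H$ be finite dimensional subspaces with $\mathcal V\oplus\mathcal W^\perp=\mathcal H$, $d=\dim\mathcal V=\dim\mathcal W$, and let $0\le\theta_1\le\dots\le\theta_d<\pi/2$ be the principal angles between $\mathcal V$ and $\mathcal W$. Let $\mathcal F=\{f_i\}_{i\in\mathbb I_n}$ be a frame for $\mathcal W$ with $\lambda(S_{\mathcal F})=(\lambda_i)_{i\in\mathbb M}$ and $\lambda(S_{\mathcal F^\#_{\mathcal V}})=(\lambda^\#_{\mathcal V,i})_{i\in\mathbb M}$. Let $\mu=(\mu_j)_{j\in\mathbb I_d}$ be the non-increasing rearrangement of $\big(\lambda_{d-j+1}^{-1}\cos^{-2}(\theta_j)\big)_{j\in\mathbb I_d}$. Then $$\prod_{j=1}^k\mu_j\;\le\;\prod_{j=1}^k\lambda^\#_{\mathcal V,j}\;\le\;\Big(\prod_{j=d-k+1}^d\lambda_j\cos^2(\theta_j)\Big)^{-1},\qquad k\in\mathbb I_d.$$ Moreover, $(\lambda^\#_{\mathcal V,j})_{j\in\mathbb I_d}=\mu$ (respectively $(\lambda^\#_{\mathcal V,j})_{j\in\mathbb I_d}=\big(\lambda_{d-j+1}^{-1}\cos^{-2}(\theta_{d-j+1})\big)_{j\in\mathbb I_d}$) if and only if there exists an orthonormal basis $\{w_j\}_{j\in\mathbb I_d}$ of $\mathcal W$ consisting of principal vectors between $\mathcal V$ and $\mathcal W$ such that $S_{\mathcal F}=\sum_{j\in\mathbb I_d}\lambda_{d-j+1}\,w_j\otimes w_j$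 (respectively $S_{\mathcal F}=\sum_{j\in\mathbb I_d}\lambda_j\,w_j\otimes w_j$).
   Context: $\mathcal H$ is a complex separable Hilbert space; $\mathbb I_k=\{1,\dots,k\}$; $\mathbb M=\mathbb I_p$ if $\dim\mathcal H=p<\infty$ and $\mathbb M=\mathbb N$ if $\dim\mathcal H=\infty$. $\mathcal V\oplus\mathcal W^\perp=\mathcal H$ means $\mathcal V+\mathcal W^\perp=\mathcal H$ and $\mathcal V\cap\mathcal W^\perp=\{0\}$. $P_{\mathcal V}$ is the orthogonal projection onto $\mathcal V$, $P_{\mathcal V//\mathcal W^\perp}$ is the oblique projection with range $\mathcal V$ and null space $\mathcal W^\perp$, $|T|=(T^*T)^{1/2}$, and $x\otimes x$ denotes $f\mapsto\langle f,x\rangle x$. Principal angles: $0\le\theta_1\le\dots\le\theta_d\le\pi/2$ are such that the $d$ largest singular values of $P_{\mathcal W}P_{\mathcal V}$, in non-increasing order, are $\cos\theta_1,\dots,\cos\theta_d$ (the others are $0$); when $\mathcal V\oplus\mathcal W^\perp=\mathcal H$ one has $\theta_d<\pi/2$. An orthonormal basis $\{w_j\}_{j\in\mathbb I_d}$ of $\mathcal W$ consists of principal vectors between $\mathcal V$ and $\mathcal W$ if $|P_{\mathcal V}P_{\mathcal W}|w_j=\cos(\theta_j)w_j$ for every $j\in\mathbb I_d$. For a finite sequence $\mathcal F=\{f_i\}_{i\in\mathbb I_n}$ in $\mathcal H$, $T_{\mathcal F}(a)=\sum_i a_if_i$ and $S_{\mathcal F}=T_{\mathcal F}T_{\mathcal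 F}^*$ is the frame operator. A finite sequence in $\mathcal W$ is a frame for $\mathcal W$ iff it spans $\mathcal W$. The canonical $\mathcal V$-dual of a frame $\mathcal F$ for $\mathcal W$ is $\mathcal F^\#_{\mathcal V}=\{P_{\mathcal V//\mathcal W^\perp}S_{\mathcal F}^\dagger f_i\}_{i\in\mathbb I_n}$ ($\dagger$ = Moore-Penrose pseudo-inverse). For a finite sequence $\mathcal G$, $\lambda(S_{\mathcal G})=(\lambda_i(S_{\mathcal G}))_{i\in\mathbb M}$ is the list of positive eigenvalues of $S_{\mathcal G}$ (with multiplicity, non-increasing) followed by zeros. *)

(* Defs.v *)
From HB Require Import structures.
From mathcomp Require Import all_boot all_order all_algebra.
From mathcomp Require Import complex.
From mathcomp Require Import all_classical all_reals all_analysis.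

Set Implicit Arguments.
Unset Strict Implicit.
Unset Printing Implicit Defensive.

Import Order.TTheory GRing.Theory Num.Theory Num.Def.
Import numFieldNormedType.Exports.

Local Open Scope classical_set_scope.
Local Open Scope complex_scope.
Local Open Scope ring_scope.

(** A complex Hilbert space: the inner product is linear in its first argument
    and conjugate-linear in the second, and it induces the complete norm. *)
HB.mixin Record isHilbert (R : realType) H
    of CompleteNormedModule R[i] H := {
  hdot : {dot H for (@conjC R[i])};
  hdotE : forall x : H, hdot x x = `|x| ^+ 2
}.

#[short(type="hilbertType")]
HB.structure Definition Hilbert (R : realType) :=
  {H of isHilbert R H & CompleteNormedModule R[i] H}.

Notation "''[' x , y ]" := (hdot x y)
  (format "''[' x ,  y ]") : ring_scope.

Definition separable (T : topologicalType) :=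
  exists2 D : set T, countable D & dense D.

Section Hilbert.
Context {R : realType} {H : hilbertType R}.
Local Notation C := R[i].
Implicit Types (V W U : set H) (S T X : H -> H).

Lemma hdotC (x y : H) : '[x, y] = conjC '[y, x].
Proof. by rewrite (hermC (hdot : {dot H for _})) expr0 mul1r. Qed.

Definition synthesis n (F : 'I_n -> H) (a : 'rV[C]_n) : H :=
  \sum_i a 0 i *: F i.

(** The adjoint of [synthesis F], see [synthesis_adjoint]. *)
Definition analysis n (F : 'I_n -> H) (x : H) : 'rV[C]_n :=
  \row_i '[x, F i].

Definition frame_op n (F : 'I_n -> H) : H -> H := synthesis F \o analysis F.

Lemma synthesis_adjoint n (F : 'I_n -> H) (a : 'rV[C]_n) (x : H) :
  '[synthesis F a, x] = dotmx a (analysis F x).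
Proof.
rewrite dotmxE mxE /synthesis linear_sumlz; apply: eq_bigr => i _.
by rewrite linearZl_LR !mxE; congr (_ * _); apply: hdotC.
Qed.

Definition span n (F : 'I_n -> H) : set H := range (synthesis F).

Definition lin_indep n (F : 'I_n -> H) :=
  forall a, synthesis F a = 0 -> a = 0.

(** This also makes [V] a linear subspace, being the span of a basis. *)
Definition has_dim V d :=
  exists2 e : 'I_d -> H, lin_indep e & span e = V.

(** A finite sequence is a frame for [W] exactly when it spans [W]. *)
Definition is_frame W n (F : 'I_n -> H) := span F = W.

Definition orthonormal_basis V d (w : 'I_d -> H) :=
  (forall i j, '[w i, w j] = (i == j)%:R) /\ span w = V.

(** [tensor x] is the operator [x ⊗ x]. *)
Definition tensor (x : H) : H -> H := fun f => '[f, x] *: x.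

Definition orthoc V : set H := [set x | forall y, V y -> '[x, y] = 0].

Definition direct_sum V U :=
  (forall x, exists v u, [/\ V v, U u & x = v + u]) /\ V `&` U = [set 0].

(** The projection with range [V] and null space [U]; it is meaningful only
    when [direct_sum V U]. *)
Definition proj_along V U : H -> H :=
  fun x => xget 0 [set y | V y /\ U (x - y)].

Definition orth_proj V : H -> H := proj_along V (orthoc V).

(** The operators below are selected by their (uniquely satisfied)
    characteristic properties, with the junk value [0] when nothing satisfies
    them. *)

Definition adjoint T : H -> H :=
  xget (fun=> 0) [set S : H -> H | forall x y, '[T x, y] = '[x, S y]].

Definition self_adjoint T := forall x y, '[T x, y] = '[x, T y].

(** The Moore-Penrose pseudo-inverse, by the four Penrose equations. *)
Definition pinv T : H -> H :=
  xget (fun=> 0) [set X : H -> H |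
    [/\ T \o X \o T = T, X \o T \o X = X,
        self_adjoint (T \o X) & self_adjoint (X \o T)]].

Definition positive_op T := linear T /\ forall x, 0 <= '[T x, x].

(** [|T|], the positive square root of [T^* T]. On a complex Hilbert space a
    positive operator defined everywhere is self-adjoint and bounded. *)
Definition abs_op T : H -> H :=
  xget (fun=> 0) [set S : H -> H |
    positive_op S /\ S \o S = adjoint T \o T].

Definition eigenspace T (t : R) : set H := [set x | T x = t%:C *: x].

(** [l] lists the positive eigenvalues of [T] in non-increasing order, each of
    them repeated according to its multiplicity, followed by zeros; it is
    indexed from 0 and, when [H] has finite dimension [p], it is padded with
    zeros beyond its first [p] entries. *)
Definition eigenvalue_list T (l : nat -> R) :=
  [/\ nonincreasing_seq l, forall i, 0 <= l i &
      forall t, 0 < t ->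
        exists2 m, has_dim (eigenspace T t) m & ([set i | l i = t] #= `I_m)%card].

Definition singular_values T (s : nat -> R) := eigenvalue_list (abs_op T) s.

Definition principal_angles V W d (theta : 'I_d -> R) :=
  [/\ forall j, 0 <= theta j <= pi / 2,
      forall i j : 'I_d, (i <= j)%N -> theta i <= theta j &
      singular_values (orth_proj W \o orth_proj V)
        (fun i => if insub i is Some j then cos (theta j) else 0)].

Definition principal_vectors V W d (theta : 'I_d -> R) (w : 'I_d -> H) :=
  orthonormal_basis W w /\
  forall j, abs_op (orth_proj V \o orth_proj W) (w j)
            = (cos (theta j))%:C *: w j.

Definition canonical_dual V W n (F : 'I_n -> H) : 'I_n -> H :=
  fun i => proj_along V (orthoc W) (pinv (frame_op F) (F i)).

End Hilbert.

Definition nonincr_rearr (R : realType) (s : seq R) : seq R :=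
  sort (fun x y => y <= x) s.

(* Main.v *)
(** Fix orthonormal bases of V and W.  In coordinates P_W restricted to V is an
    invertible matrix N, the frame operator of F is a positive definite S, and
    the oblique projection restricted to W inverts N, so that the frame operator
    of the canonical V-dual is M = N^-* S^-1 N^-1, while N N^* and N^* N have
    eigenvalues cos^2(theta_j).  Both product inequalities are instances of the
    Gelfand-Naimark inequality
      prod_J lambda(K B K^* ) <= prod_J lambda(K K^* ) prod_{i < #J} lambda(B),
    the lower one with K = N^*, B = M (so K B K^* = S^-1), the upper one with
    K = N^-*, B = S^-1 (so K B K^* = M).  In the equality cases the trace of
    S^-1 (N^* N)^-1, which is that of M, attains the extremal value allowed by
    the von Neumann trace inequality; this forces S and N^* N to have a common
    orthonormal eigenbasis with the corresponding ordering. *)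

Require Import Defs.
From mathcomp Require Import all_boot all_order all_algebra.
From mathcomp Require Import complex.
From mathcomp Require Import all_classical all_reals all_analysis.
From mathcomp Require Import perm finmap ring lra zify.

Set Implicit Arguments.
Unset Strict Implicit.
Unset Printing Implicit Defensive.

Import Order.TTheory GRing.Theory Num.Theory Num.Def.
Local Open Scope classical_set_scope.
Local Open Scope complex_scope.
Local Open Scope ring_scope.

(** * Conjugate transposes *)

Section ConjugateTranspose.
Local Open Scope sesquilinear_scope.
Context {C : numClosedFieldType}.

(** Coordinates are rows and matrices act on them from the right, so products appear in the reverse
    order of the operators, and the rows of a diagonalising unitary are the eigenvectors. The trace
    suffices for the equality cases because the two extremal lists pair the inverse eigenvalues of
    [S] and of [N^* N] in opposite and in equal order, which gives the minimum and the maximum of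
    the trace; so the sum of the prescribed list already decides. On the side of [H] the obstacle is
    that the adjoint, |T|, the projections and the pseudo-inverse are chosen by [xget] from a
    specification, and that [H] may be infinite dimensional. They are therefore reached through
    their defining properties only, and multiplicities are compared at positive eigenvalues, whose
    eigenvectors lie in the span of the chosen finite basis. *)

Lemma trmxC_mul m n p (A : 'M[C]_(m, n)) (B : 'M[C]_(n, p)) :
  (A *m B)^t* = B^t* *m A^t*.
Proof. by rewrite trmx_mul map_mxM. Qed.

Lemma trmxC_mul3 m n p q (A : 'M[C]_(m, n)) (B : 'M[C]_(n, p)) (D : 'M[C]_(p, q)) :
  (A *m B *m D)^t* = D^t* *m B^t* *m A^t*.
Proof. by rewrite trmxC_mul (trmxC_mul A) mulmxA. Qed.

Lemma conjC_form m n (u : 'rV[C]_m) (A : 'M[C]_(m, n)) (v : 'rV[C]_n) :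
  ((u *m A *m v^t*) 0 0)^* = (v *m A^t* *m u^t*) 0 0.
Proof. by rewrite -[v in RHS]trmxCK -trmxC_mul3 !mxE. Qed.

Lemma trmxC_gram m n (A : 'M[C]_(m, n)) : (A^t* *m A)^t* = A^t* *m A.
Proof. by rewrite trmxC_mul trmxCK. Qed.

Lemma gram_congr m n p (A : 'M[C]_(m, n)) (B : 'M[C]_(n, p)) :
  A *m (B *m B^t*) *m A^t* = (A *m B) *m (A *m B)^t*.
Proof. by rewrite trmxC_mul !mulmxA. Qed.

Lemma gramC_congr m n p (A : 'M[C]_(m, n)) (B : 'M[C]_(p, n)) :
  A *m (B^t* *m B) *m A^t* = (A *m B^t*) *m (A *m B^t*)^t*.
Proof. by rewrite trmxC_mul trmxCK !mulmxA. Qed.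

Lemma mulmx_trmxC_gt0 n (v : 'rV[C]_n) : v != 0 -> 0 < (v *m v^t*) 0 0.
Proof. by rewrite -dotmxE; exact: dotmx_is_dotmx. Qed.

Lemma trmxC_invmx n (A : 'M[C]_n) : (invmx A)^t* = invmx (A^t*).
Proof. by rewrite trmx_inv map_invmx. Qed.

Lemma trmxC_unitmx n (A : 'M[C]_n) : (A^t* \in unitmx) = (A \in unitmx).
Proof. by rewrite map_unitmx unitmx_tr. Qed.

Lemma mulmx_trmxC_sum n (v : 'rV[C]_n) :
  (v *m v^t*) 0 0 = \sum_i `|v 0 i| ^+ 2.
Proof. by rewrite mxE; apply: eq_bigr => i _; rewrite !mxE normCK. Qed.

Lemma unitarymx_norm n (U : 'M[C]_n) (v : 'rV[C]_n) : U \is unitarymx ->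
  (v *m U *m (v *m U)^t*) = v *m v^t*.
Proof. by move=> UU; rewrite trmxC_mul mulmxA mulmxtVK. Qed.

Lemma trmxC_unitary_mul n (U : 'M[C]_n) : U \is unitarymx -> U^t* *m U = 1%:M.
Proof.
by rewrite -trmxC_unitary => /unitarymxP; rewrite trmxCK.
Qed.

End ConjugateTranspose.

(** * Eigenvalue inequalities for Hermitian matrices *)

Definition noninc {D : numDomainType} n (x : 'I_n -> D) :=
  forall i j : 'I_n, (i <= j)%N -> x j <= x i.

(** * Optimality in the assignment problem with monotone gains *)

Section Rearrangement.
Context {D : numDomainType}.

(* Dual solutions of the assignment problem with gains [a i * b j], whose
   optimal assignment is the identity. *)
Lemma rearrangement_potentials n (a b : 'I_n -> D) : noninc a -> noninc b ->
  exists f g : 'I_n -> D, (forall i j, a i * b j <= f i + g j) /\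
    forall i, f i + g i = a i * b i.
Proof.
case: n a b => [|n] a b ad bd.
  by exists a, b; split=> [[]|[]].
pose A m := a (inord m); pose B m := b (inord m).
have Ad l m : (l <= m)%N -> (m <= n)%N -> A m <= A l.
  by move=> lm mn; apply: ad; rewrite !inordK// ltnS (leq_trans lm).
have Bd l m : (l <= m)%N -> (m <= n)%N -> B m <= B l.
  by move=> lm mn; apply: bd; rewrite !inordK// ltnS (leq_trans lm).
(* [f] is a discrete integral of [b] against the increments of [a]; [g] is then forced by tightness
   on the diagonal. *)
pose f m := \sum_(0 <= l < m) (A l.+1 - A l) * B l.
have fB l m : (l <= m)%N -> f m - f l = \sum_(l <= k < m) (A k.+1 - A k) * B k.
  by move=> lm; rewrite /f (@big_cat_nat _ _ _ l)//= addrAC subrr add0r.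
have AB l m k : (l <= m)%N ->
    (A m - A l) * B k = \sum_(l <= h < m) (A h.+1 - A h) * B k.
  by move=> lm; rewrite -mulr_suml telescope_sumr.
exists (fun i => f i), (fun j => A j * B j - f j); split=> [i j|i]; last first.
  by rewrite addrCA subrr addr0 /A /B inord_val.
(* Both sides sum the increments of [a] between [i] and [j], with weight the constant [B j] on the
   left and the running value of [b] on the right; the increments are nonpositive and [b] is
   monotone. *)
suff : (A i - A j) * B j <= f i - f j.
  have [-> ->] : a i = A i /\ b j = B j by rewrite /A /B !inord_val.
  by rewrite mulrBl lerBlDr => H; rewrite (_ : f i + _ = f i - f j + A j * B j)//; ring.
have [ij|/ltnW ji] := leqP i j.
  rewrite -lerN2 -mulNr !opprB fB// AB//.
  rewrite big_nat [leRHS]big_nat; apply: ler_sum => k /andP[ik kj].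
  have kn : (k < n)%N by rewrite (leq_trans kj)// -ltnS.
  by apply: ler_wnM2l; [rewrite subr_le0 Ad|rewrite Bd ?(ltnW kj)// -ltnS].
rewrite fB// AB// big_nat [leRHS]big_nat; apply: ler_sum => k /andP[jk ki].
have kn : (k < n)%N by rewrite (leq_trans ki)// -ltnS.
by apply: ler_wnM2l; [rewrite subr_le0 Ad|rewrite Bd// ltnW].
Qed.

(* Complementary slackness for the potentials above: an optimal doubly
   stochastic matrix is supported where they are tight. *)
Lemma rearrangement_support n (a b : 'I_n -> D) (p : 'I_n -> 'I_n -> D) :
  noninc a -> noninc b -> (forall i j, 0 <= p i j) ->
  (forall i, \sum_j p i j = 1) -> (forall j, \sum_i p i j = 1) ->
  \sum_i \sum_j p i j * (a i * b j) = \sum_i a i * b i ->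
  forall i j k l, p i j != 0 -> p k l != 0 -> 0 <= (a i - a k) * (b j - b l).
Proof.
move=> ad bd p0 pr pc pE; have [f [g [fg fgE]]] := rearrangement_potentials ad bd.
have h i j : 0 <= p i j * (f i + g j - a i * b j).
  by rewrite mulr_ge0// subr_ge0.
(* The marginals of [p] turn the total of the potentials into the optimal gain, so the nonnegative
   slacks sum to zero. *)
have s0 : \sum_i \sum_j p i j * (f i + g j - a i * b j) = 0.
  under eq_bigr do under eq_bigr do rewrite mulrBr mulrDr.
  under eq_bigr do rewrite sumrB big_split -mulr_suml/= pr mul1r.
  rewrite sumrB pE big_split/= exchange_big/=.
  under [X in _ + X - _]eq_bigr do rewrite -mulr_suml pc mul1r.
  by rewrite -big_split/= (eq_bigr _ (fun i _ => fgE i)) subrr.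
have tight i j : p i j != 0 -> f i + g j = a i * b j.
  move=> pij; have /(_ i isT) := psumr_eq0P (fun i _ => sumr_ge0 _ (fun j _ => h i j)) s0.
  move=> /(psumr_eq0P (fun j _ => h i j)) /(_ j isT) /eqP.
  by rewrite mulf_eq0 (negbTE pij) subr_eq0 => /eqP.
move=> i j k l /tight ij /tight kl.
have -> : (a i - a k) * (b j - b l) = (a i * b j + a k * b l) - (a i * b l + a k * b j).
  by ring.
rewrite -ij -kl (_ : f i + _ + _ = f i + g l + (f k + g j)); last by ring.
by rewrite subr_ge0 lerD.
Qed.

End Rearrangement.

(* [r2c] stands for [real_complex : R -> R[i]]; the field is kept abstract
   because unification in [R[i]] itself unfolds the complex arithmetic. *)
Section Spectrum.
Local Open Scope sesquilinear_scope.
Context {R : realFieldType} {C : numClosedFieldType} (r2c : {rmorphism R -> C}).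
Context (r2c_le : {mono r2c : x y / x <= y}).
Context (r2c_real : forall z, z \is Num.real -> exists x, z = r2c x).

Lemma conj_r2c x : (r2c x)^* = r2c x.
Proof.
apply/CrealP; rewrite realE -(rmorph0 r2c) !r2c_le.
exact: num_real.
Qed.

Lemma gram_unitmx m n (A : 'M[C]_(m, n)) :
  (forall v : 'rV[C]_n, v != 0 -> v *m A^t* != 0) -> A^t* *m A \in unitmx.
Proof.
move=> A0; rewrite unitmxE unitfE; apply/negP => /det0P[v v0 vA].
have := mulmx_trmxC_gt0 (A0 v v0).
by rewrite trmxC_mul trmxCK mulmxA -[v *m _ *m _]mulmxA vA mul0mx mxE ltxx.
Qed.

Lemma unitmx_row_neq0 n (A : 'M[C]_n) (v : 'rV[C]_n) :
  A \in unitmx -> v != 0 -> v *m A != 0.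
Proof.
by move=> uA; apply: contra => /eqP vA; rewrite -(mulmxK uA v) vA mul0mx.
Qed.

(** When the rows of [A] are the coordinates of the frame, those of
    [A *m invmx (A^t* *m A) *m invmx N] are the coordinates of its canonical oblique dual; the inner
    [A^t* *m A] cancels one of the two inverses. *)
Lemma dual_gram m n (A : 'M[C]_(m, n)) (N : 'M[C]_n) : A^t* *m A \in unitmx ->
  (A *m invmx (A^t* *m A) *m invmx N)^t* *m (A *m invmx (A^t* *m A) *m invmx N) =
  (invmx N)^t* *m invmx (A^t* *m A) *m invmx N.
Proof.
move=> uS; rewrite trmxC_mul3 (trmxC_invmx (A^t* *m A)) trmxC_gram.
by rewrite !mulmxA -(mulmxA _ (A^t*)) mulmxKV.
Qed.

Lemma dual_gram_posdef m n (A : 'M[C]_(m, n)) (N : 'M[C]_n) (v : 'rV[C]_n) :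
  (forall v : 'rV[C]_n, v != 0 -> v *m A^t* != 0) -> N \in unitmx -> v != 0 ->
  0 < (v *m ((invmx N)^t* *m invmx (A^t* *m A) *m invmx N) *m v^t*) 0 0.
Proof.
move=> A0 uN v0; have uS := gram_unitmx A0.
rewrite -(dual_gram N uS) gramC_congr; apply: mulmx_trmxC_gt0.
rewrite trmxC_mul3 (trmxC_invmx (A^t* *m A)) trmxC_gram !mulmxA.
apply: A0; rewrite -mulmxA; apply: unitmx_row_neq0 => //.
by rewrite unitmx_mul trmxC_unitmx !unitmx_inv uN.
Qed.

Definition rdiag n (x : 'I_n -> R) : 'M[C]_n := diag_mx (\row_j r2c (x j)).

Lemma mul_rdiag m n (x : 'I_m -> R) (A : 'M[C]_(m, n)) i j :
  (rdiag x *m A) i j = r2c (x i) * A i j.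
Proof. by rewrite mul_diag_mx !mxE. Qed.

Lemma mul_mx_rdiag m n (x : 'I_n -> R) (A : 'M[C]_(m, n)) i j :
  (A *m rdiag x) i j = A i j * r2c (x j).
Proof. by rewrite mul_mx_diag !mxE. Qed.

(** A spectrum with multiplicities, in any order; the real diagonal makes [M] Hermitian, and row [i]
    of [U] is a left eigenvector for [x i]. *)
Definition eigs n (M : 'M[C]_n) (x : 'I_n -> R) :=
  exists2 U, U \is unitarymx & M = U^t* *m rdiag x *m U.

Lemma unitarymx_intertwine n (U X : 'M[C]_n) x : U \is unitarymx ->
  U *m X = rdiag x *m U -> X = U^t* *m rdiag x *m U.
Proof.
by move=> uU UX; rewrite -mulmxA -UX mulmxA trmxC_unitary_mul// mul1mx.
Qed.

Lemma eigs_herm n (M : 'M[C]_n) x : eigs M x -> M^t* = M.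
Proof.
move=> [U _ ->]; rewrite trmxC_mul (trmxC_mul (U^t*)) trmxCK mulmxA; congr (_ *m _ *m _).
rewrite /rdiag tr_diag_mx map_diag_mx; congr diag_mx.
by apply/rowP => j; rewrite !mxE; exact: conj_r2c.
Qed.

Lemma eigs_det n (M : 'M[C]_n) x : eigs M x -> \det M = r2c (\prod_i x i).
Proof.
move=> [U uU ->]; have dU : \det (U^t*) * \det U = 1.
  by rewrite -det_mulmx (trmxC_unitary_mul uU) det1.
rewrite !det_mulmx mulrAC dU mul1r det_diag rmorph_prod /=.
by apply: eq_bigr => i _; rewrite mxE.
Qed.

Lemma eigs_qform n (M U : 'M[C]_n) x (v : 'rV[C]_n) : M = U^t* *m rdiag x *m U ->
  (v *m M *m v^t*) 0 0 = \sum_i r2c (x i) * `|(v *m U^t*) 0 i| ^+ 2.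
Proof.
move=> ->; rewrite !mulmxA -[_ *m U *m _]mulmxA.
have -> : U *m v^t* = (v *m U^t*)^t* by rewrite trmxC_mul trmxCK.
rewrite mul_mx_diag mxE; apply: eq_bigr => i _.
by rewrite !mxE mulrAC -normCK mulrC.
Qed.

(* Courant-Fischer without subspaces: the square matrix [Z] encodes the [n - 1]
   equations saying that [v] lies in the span of the first [j + 1]
   eigenvectors of [X] and of the last [n - j] eigenvectors of [Y]. *)
Lemma eigs_le n (X Y : 'M[C]_n) x y : noninc x -> noninc y ->
  eigs X x -> eigs Y y ->
  (forall v : 'rV[C]_n, (v *m X *m v^t*) 0 0 <= (v *m Y *m v^t*) 0 0) ->
  forall j, x j <= y j.
Proof.
move=> xd yd [U uU XE] [W uW YE] XY j.
pose Z : 'M[C]_n := \matrix_(i, k) if (j < k)%N then U^t* i k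
                     else if (k < j)%N then W^t* i k else 0.
have /eqP/det0P[v v0 vZ] : \det Z = 0.
  rewrite -det_tr (expand_det_row _ j) big1// => k _.
  by rewrite !mxE ltnn mul0r.
have vU (k : 'I_n) : (j < k)%N -> (v *m U^t*) 0 k = 0.
  move=> jk; move/rowP/(_ k): vZ; rewrite mxE [RHS]mxE => vZ.
  by rewrite mxE -[RHS]vZ; apply: eq_bigr => i _; rewrite [Z _ _]mxE jk.
have vW (k : 'I_n) : (k < j)%N -> (v *m W^t*) 0 k = 0.
  move=> kj; move/rowP/(_ k): vZ; rewrite mxE [RHS]mxE => vZ.
  rewrite mxE -[RHS]vZ; apply: eq_bigr => i _.
  by rewrite [Z _ _]mxE kj ltnNge ltnW.
have nrm (Q : 'M[C]_n) : Q \is unitarymx ->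
    \sum_i `|(v *m Q^t*) 0 i| ^+ 2 = (v *m v^t*) 0 0.
  by move=> uQ; rewrite -mulmx_trmxC_sum (unitarymx_norm v (etrans (trmxC_unitary Q) uQ)).
have vv := mulmx_trmxC_gt0 v0.
have h1 : r2c (x j) * (v *m v^t*) 0 0 <= (v *m X *m v^t*) 0 0.
  rewrite (eigs_qform _ XE) -(nrm U uU) mulr_sumr; apply: ler_sum => i _.
  have [ij|ji] := leqP i j; last by rewrite vU// normr0 expr0n/= !mulr0.
  by rewrite ler_wpM2r ?exprn_ge0// r2c_le xd.
have h2 : (v *m Y *m v^t*) 0 0 <= r2c (y j) * (v *m v^t*) 0 0.
  rewrite (eigs_qform _ YE) -(nrm W uW) mulr_sumr; apply: ler_sum => i _.
  have [ji|ij] := leqP j i; last by rewrite vW// normr0 expr0n/= !mulr0.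
  by rewrite ler_wpM2r ?exprn_ge0// r2c_le yd.
by have := le_trans h1 (le_trans (XY v) h2); rewrite ler_pM2r// r2c_le.
Qed.

Lemma eigs_uniq n (X : 'M[C]_n) x y : noninc x -> noninc y ->
  eigs X x -> eigs X y -> x =1 y.
Proof.
move=> xd yd Xx Xy j; apply/eqP; rewrite eq_le.
by rewrite (eigs_le xd yd Xx Xy)// (eigs_le yd xd Xy Xx).
Qed.

Lemma row_perm_unitarymx n (U : 'M[C]_n) (s : 'S_n) :
  U \is unitarymx -> row_perm s U \is unitarymx.
Proof.
move=> uU; apply/unitarymxP/matrixP => i j; move/unitarymxP/matrixP/(_ (s i) (s j)): uU.
rewrite !mxE (inj_eq perm_inj) => <-; apply: eq_bigr => k _; rewrite !mxE//.
Qed.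

Lemma row_perm_rdiag n (U : 'M[C]_n) (s : 'S_n) x :
  (row_perm s U)^t* *m rdiag (x \o s) *m row_perm s U = U^t* *m rdiag x *m U.
Proof.
apply/matrixP => i j; rewrite !mul_mx_diag mxE [RHS]mxE.
rewrite [RHS](reindex_inj (@perm_inj _ s)).
by apply: eq_bigr => k _; rewrite !mxE.
Qed.

Lemma eigs_perm n (M : 'M[C]_n) x (s : 'S_n) : eigs M x -> eigs M (x \o s).
Proof.
move=> [U uU ->]; exists (row_perm s U); first exact: row_perm_unitarymx.
by rewrite row_perm_rdiag.
Qed.

Lemma herm_eigs n (M : 'M[C]_n) : M^t* = M -> exists x, eigs M x.
Proof.
move=> MM; have hM : M \is hermsymmx by apply/is_hermitianmxP; rewrite expr0 scale1r MM.
have /orthomx_spectralP ME := hermitian_normalmx hM.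
have rs := hermitian_spectral_diag_real hM.
pose x j := sval (cid (r2c_real (mxOverP rs 0 j))).
have xE j : spectral_diag M 0 j = r2c (x j) by rewrite /x; case: cid.
exists x, (spectralmx M); first exact: spectral_unitarymx.
rewrite {1}ME (invmx_unitary (spectral_unitarymx M)) /rdiag.
by congr (_ *m diag_mx _ *m _); apply/rowP => j; rewrite mxE.
Qed.

(** The sorted sequence itself is described, so that the lemma applies to the [mu] of the
    theorem. *)
Lemma sort_ge_perm n (x : 'I_n -> R) : exists2 s : 'S_n, noninc (x \o s) &
  forall i : 'I_n,
    (sort (fun a b => b <= a) [seq x j | j <- enum 'I_n])`_i = x (s i).
Proof.
pose r : rel R := fun a b => b <= a.
have rtot : total r by move=> a b; exact: le_total.
have rtr : transitive r by move=> a b c h1 h2; exact: le_trans h2 h1.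
set xs := [seq x j | j <- enum 'I_n].
have sz : size (sort r xs) == n by rewrite size_sort size_map size_enum_ord.
have /tuple_permP[s sE] : perm_eq (Tuple sz) [tuple x i | i < n].
  by rewrite perm_sort.
have E (i : 'I_n) : (sort r xs)`_i = x (s i).
  by rewrite [sort _ _]sE -tnth_nth !tnth_mktuple.
exists s => // i j ij /=; rewrite -!E.
have /(sorted_leq_nth rtr) := sort_sorted rtot xs.
by apply; rewrite ?inE ?(eqP sz)// => k; exact: lexx.
Qed.

Lemma noninc_perm n (x : 'I_n -> R) : exists s : 'S_n, noninc (x \o s).
Proof. by have [s xs _] := sort_ge_perm x; exists s. Qed.

Lemma herm_eigs_noninc n (M : 'M[C]_n) : M^t* = M -> exists2 x, noninc x & eigs M x.
Proof.
move=> /herm_eigs[x Mx]; have [s xs] := noninc_perm x.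
by exists (x \o s) => //; apply: eigs_perm.
Qed.

Lemma card_ord_lt n k : (k <= n)%N -> #|[pred i : 'I_n | (i < k)%N]| = k.
Proof.
by move=> kn; rewrite -sum1_card (big_ord_narrow kn) sum1_card card_ord.
Qed.

Lemma eigs_scale n (M : 'M[C]_n) c x : eigs M x ->
  eigs (r2c c *: M) (fun i => c * x i).
Proof.
move=> [U uU ->]; exists U => //; rewrite scalemxAl scalemxAr.
congr (_ *m _ *m _); apply/matrixP => i j; rewrite !mxE.
by rewrite rmorphM mulrnAr.
Qed.

Lemma congr_qform n (K B : 'M[C]_n) (v : 'rV[C]_n) :
  v *m (K *m B *m K^t*) *m v^t* = (v *m K) *m B *m (v *m K)^t*.
Proof. by rewrite trmxC_mul !mulmxA. Qed.

(* The Li-Mathias argument: replacing every eigenvalue [b i] of [B] beyond the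
   first [#|J|] by [c], the least of these, increases [K *m B *m K^t*], whose
   eigenvalues then all dominate those of [c *: K *m K^t*]; the product of
   the quotients over [J] is at most the quotient of the determinants. *)
Lemma eigs_prod_le n (K B : 'M[C]_n) b x y (J : {set 'I_n}) :
  noninc b -> noninc x -> noninc y ->
  (forall i, 0 < b i) -> (forall i, 0 < x i) -> (forall i, 0 <= y i) ->
  eigs B b -> eigs (K *m K^t*) x -> eigs (K *m B *m K^t*) y ->
  \prod_(i in J) y i <=
  \prod_(i in J) x i * \prod_(i < n | (i < #|J|)%N) b i.
Proof.
move=> bd xd yd b0 x0 y0 eB eX eY.
(* The empty [J] is split off because [c] is the value of [b] at the last of the first [#|J|]
   indices. *)
have [J0|/card_gt0P[i0 i0J]] := posnP #|J|.
  by rewrite J0 (cards0_eq J0) !big_set0 big_pred0// mulr1.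
have k0 : (0 < #|J|)%N by apply/card_gt0P; exists i0.
have kn : (#|J| <= n)%N by rewrite -[leqRHS]card_ord max_card.
have km : (#|J|.-1 < n)%N by rewrite prednK.
pose m := Ordinal km; pose c := b m; have c0 : 0 < c by exact: b0.
pose b' (i : 'I_n) := if (i < #|J|)%N then b i else c.
have cb' i : c <= b' i.
  by rewrite /b'; case: ifP => // ik; apply: bd; rewrite /= -ltnS prednK.
have bb' i : b i <= b' i.
  rewrite /b'; case: ifP => // /negbT; rewrite -leqNgt => ki.
  by apply: bd; rewrite /= (leq_trans _ ki)// leq_pred.
have [U uU BE] := eB; pose B' := U^t* *m rdiag b' *m U.
have eB' : eigs B' b' by exists U.
have [|z zd ez] := @herm_eigs_noninc _ (K *m B' *m K^t*).
  by rewrite trmxC_mul (trmxC_mul K) trmxCK (eigs_herm eB') mulmxA.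
have yz i : y i <= z i.
  apply: (eigs_le yd zd eY ez) => v; rewrite !congr_qform.
  rewrite (eigs_qform _ BE) (eigs_qform _ (erefl B')); apply: ler_sum => j _.
  by rewrite ler_wpM2r ?exprn_ge0// r2c_le.
have xz i : c * x i <= z i.
  apply: (eigs_le _ zd (eigs_scale c eX) ez) => [j k jk|v].
    by rewrite ler_pM2l// xd.
  rewrite congr_qform (eigs_qform _ (erefl B')) -scalemxAr -scalemxAl.
  have -> : v *m (K *m K^t*) *m v^t* = v *m K *m (v *m K)^t*.
    by rewrite trmxC_mul !mulmxA.
  have uU' : U^t* \is unitarymx by rewrite trmxC_unitary.
  rewrite mxE -(unitarymx_norm (v *m K) uU') mulmx_trmxC_sum mulr_sumr.
  by apply: ler_sum => j _; rewrite ler_wpM2r ?exprn_ge0// r2c_le.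
have detE : \prod_i z i = \prod_i x i * \prod_i b' i.
  apply: (fmorph_inj r2c); rewrite rmorphM -(eigs_det ez) -(eigs_det eX).
  by rewrite -(eigs_det eB') !det_mulmx mulrAC.
have cx0 i : 0 < c * x i by rewrite mulr_gt0.
have z0 i : 0 < z i by exact: lt_le_trans (xz i).
apply: (@le_trans _ _ (\prod_(i in J) z i)).
  by apply: ler_prod => i _; rewrite y0 yz.
have pc : 0 < \prod_(i | i \notin J) (c * x i) by apply: prodr_gt0.
rewrite -(ler_pM2r pc).
apply: (@le_trans _ _ (\prod_(i in J) z i * \prod_(i | i \notin J) z i)).
  rewrite ler_wpM2l//; first by apply: prodr_ge0 => i _; apply: ltW.
  by apply: ler_prod => i _; rewrite xz ltW.
(* [J] and the initial segment of length [#|J|] have complements of equal size, so these factors [c]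
   are exactly those of [b'] beyond the segment. *)
have -> : \prod_(i | i \notin J) (c * x i) =
    \prod_(i < n | ~~ (i < #|J|)%N) c * \prod_(i | i \notin J) x i.
  rewrite big_split/= !prodr_const; congr (_ ^+ _ * _).
  rewrite -[LHS](addKn #|J|) -[X in (_ - X)%N = _](card_ord_lt kn).
  by rewrite cardC -(cardC (fun i : 'I_n => (i < #|J|)%N)) addKn.
have -> : \prod_(i in J) z i * \prod_(i | i \notin J) z i = \prod_i z i.
  by rewrite [RHS](bigID (mem J)).
rewrite detE (bigID (mem J))/=.
rewrite (bigID (fun i : 'I_n => (i < #|J|)%N) _ b')/=.
rewrite [X in _ * (X * _) <= _](eq_bigr b) => [|i ik]; last by rewrite /b' ik.
rewrite [X in _ * (_ * X) <= _](eq_bigr (fun=> c)) => [|i /negbTE ik].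
  by rewrite le_eqVlt; apply/orP; left; apply/eqP; ring.
by rewrite /b' ik.
Qed.

(** * Equality in the von Neumann trace inequality *)

Lemma mxtrace_eigs n (U : 'M[C]_n) a b : U \is unitarymx ->
  \tr ((U^t* *m rdiag a *m U) *m (U^t* *m rdiag b *m U)) = r2c (\sum_i a i * b i).
Proof.
move=> uU; have -> : U^t* *m rdiag a *m U *m (U^t* *m rdiag b *m U) =
    U^t* *m (rdiag a *m rdiag b *m U) by rewrite !mulmxA mulmxtVK.
rewrite mxtrace_mulC mulmxtVK// mul_diag_mx rmorph_sum; apply: eq_bigr => i _.
by rewrite !mxE eqxx mulr1n rmorphM.
Qed.

Lemma unitarymx_row_sum n (U : 'M[C]_n) i k : U \is unitarymx ->
  \sum_j U i j * (U k j)^* = (i == k)%:R.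
Proof.
move=> /unitarymxP/matrixP/(_ i k); rewrite !mxE => <-.
by apply: eq_bigr => j _; rewrite !mxE.
Qed.

(* The squared moduli of the transition matrix [X] between the two eigenbases
   form a doubly stochastic matrix, optimal by the hypothesis on the trace.  So
   if [a i != a k], then [d] is constant on the common support of rows [i] and
   [k] of [X], and these rows are orthogonal. *)
Lemma eigs_trace_comm n (A D : 'M[C]_n) a d : noninc a -> noninc d ->
  eigs A a -> eigs D d -> \tr (A *m D) = r2c (\sum_i a i * d i) ->
  A *m D = D *m A.
Proof.
move=> ad dd [U uU AE] [W uW DE] trE; pose X := U *m W^t*.
have uX : X \is unitarymx by rewrite mul_unitarymx// trmxC_unitary.
have XE : X^t* = W *m U^t* by rewrite trmxC_mul trmxCK.
pose p i j := `|X i j| ^+ 2.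
have ADE : U *m (A *m D) *m U^t* = rdiag a *m (X *m rdiag d *m X^t*).
  by rewrite AE DE XE /X !mulmxA (unitarymxP uU) mul1mx.
have DAE : U *m (D *m A) *m U^t* = X *m rdiag d *m X^t* *m rdiag a.
  by rewrite AE DE XE /X !mulmxA mulmxtVK.
have YE i k : (X *m rdiag d *m X^t*) i k = \sum_j r2c (d j) * (X i j * (X k j)^*).
  rewrite mul_mx_diag mxE; apply: eq_bigr => j _.
  by rewrite !mxE mulrAC mulrC.
have sup i j k l : p i j != 0 -> p k l != 0 -> 
    0 <= (r2c (a i) - r2c (a k)) * (r2c (d j) - r2c (d l)).
  apply: (@rearrangement_support _ _ (fun i => r2c (a i)) (fun j => r2c (d j)) p).
  - by move=> i' j' ij; rewrite r2c_le ad.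
  - by move=> i' j' ij; rewrite r2c_le dd.
  - by move=> i' j'; rewrite exprn_ge0.
  - move=> i'; rewrite /p; under eq_bigr do rewrite normCK.
    by rewrite unitarymx_row_sum// eqxx.
  - move=> j'; have /(unitarymx_row_sum j' j') : X^t* \is unitarymx by rewrite trmxC_unitary.
    rewrite eqxx; apply: etrans; apply: eq_bigr => i' _.
    by rewrite /p !mxE conjCK normCK mulrC.
  (* In the eigenbasis of [A] the trace is the gain of [p], so the hypothesis on the trace says that
     [p] is optimal. *)
  - transitivity (\tr (A *m D)).
      rewrite -[RHS]mulr1; transitivity (\tr (U *m (A *m D) *m U^t*)); last first.
        by rewrite -mulmxA mxtrace_mulC mulmxKtV// mulr1.
      rewrite ADE; apply: eq_bigr => i' _; rewrite mul_rdiag YE mulr_sumr.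
      by apply: eq_bigr => j' _; rewrite /p normCK; ring.
    by rewrite trE rmorph_sum; apply: eq_bigr => i' _; rewrite rmorphM.
suff E : U *m (A *m D) *m U^t* = U *m (D *m A) *m U^t*.
  have Uu := unitarymx_unit uU.
  have U'u : U^t* \in unitmx by rewrite trmxC_unitmx.
  by move: E => /(can_inj (mulmxK U'u)) /(can_inj (mulKmx Uu)).
rewrite ADE DAE; apply/matrixP => i k; rewrite mul_rdiag mul_mx_rdiag mulrC.
have [->//|aik] := eqVneq (a i) (a k).
suff -> : (X *m rdiag d *m X^t*) i k = 0 by rewrite !mul0r.
rewrite YE; have [j0 /andP[ij0 kj0]|noj] := pickP [pred j | (X i j != 0) && (X k j != 0)].
  rewrite (eq_bigr (fun j => r2c (d j0) * (X i j * (X k j)^*))) => [|j _].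
    rewrite -mulr_sumr unitarymx_row_sum//; case: eqP => [ik|]; last by rewrite mulr0.
    by rewrite ik eqxx in aik.
  have [->|ij] := eqVneq (X i j) 0; first by rewrite !(mul0r, mulr0).
  have [->|kj] := eqVneq (X k j) 0; first by rewrite conjC0 !mulr0.
  congr (_ * _).
  have P u v : X u v != 0 -> p u v != 0 by rewrite /p expf_eq0/= normr_eq0.
  (* Exchanging [j] and [j0] changes the sign of the product, which is nonnegative both times and
     hence zero. *)
  have := sup i j k j0 (P _ _ ij) (P _ _ kj0).
  have := sup i j0 k j (P _ _ ij0) (P _ _ kj).
  rewrite -[X in 0 <= _ * X -> _]opprB mulrN oppr_ge0 => h1 h2.
  have /eqP : (r2c (a i) - r2c (a k)) * (r2c (d j) - r2c (d j0)) = 0.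
    by apply/eqP; rewrite eq_le h1.
  by rewrite mulf_eq0 !subr_eq0 (inj_eq (fmorph_inj r2c)) (negbTE aik)/= => /eqP.
rewrite big1// => j _; have /= := noj j.
by move=> /negbT; rewrite negb_and !negbK => /orP[]/eqP->; rewrite ?conjC0 !(mulr0,mul0r).
Qed.

(** Commutation makes [A + 'i *: D] normal; its spectral theorem diagonalises [A] and [D] together,
    with the real and imaginary parts of its eigenvalues. *)
Lemma herm_comm_eigs n (A D : 'M[C]_n) : A^t* = A -> D^t* = D -> A *m D = D *m A ->
  exists (U : 'M[C]_n) a b, [/\ U \is unitarymx, A = U^t* *m rdiag a *m U &
                    D = U^t* *m rdiag b *m U].
Proof.
move=> hA hD AD; pose Z := A + 'i *: D.
have ZsE : Z^t* = A - 'i *: D.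
  apply/matrixP => i j; move/matrixP/(_ i j): hA; move/matrixP/(_ i j): hD.
  by rewrite !mxE rmorphD rmorphM /= conjCi mulNr => -> ->.
have /orthomx_spectralP : Z \is normalmx.
  apply/normalmxP; rewrite ZsE /Z !(mulmxDl, mulmxDr, mulmxN, mulNmx).
  by rewrite -!scalemxAl -!scalemxAr AD addrA subrK [RHS]addrA addrK.
set P := spectralmx Z; set z := spectral_diag Z.
have uP : P \is unitarymx by apply: spectral_unitarymx.
rewrite (invmx_unitary uP) => ZE.
pose a i := sval (cid (r2c_real (Creal_Re (z 0 i)))).
pose b i := sval (cid (r2c_real (Creal_Im (z 0 i)))).
have aE i : 'Re (z 0 i) = r2c (a i) by rewrite /a; case: cid.
have bE i : 'Im (z 0 i) = r2c (b i) by rewrite /b; case: cid.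
have ZsE' : Z^t* = P^t* *m diag_mx (map_mx conjC z) *m P.
  rewrite {1}ZE trmxC_mul (trmxC_mul (P^t*)) trmxCK mulmxA; congr (_ *m _ *m _).
  by rewrite tr_diag_mx map_diag_mx.
exists P, a, b; split=> //.
  have -> : rdiag a = 2^-1 *: (diag_mx z + diag_mx (map_mx conjC z)).
    rewrite -linearD/= -linearZ/=; congr diag_mx; apply/rowP => j.
    by rewrite !mxE -aE ReE mulrC.
  rewrite -scalemxAr -scalemxAl mulmxDr mulmxDl -ZE -ZsE' ZsE /Z.
  by rewrite addrACA subrr addr0 -mulr2n -scaler_nat scalerA mulVf ?pnatr_eq0// scale1r.
have -> : rdiag b = ('i / 2) *: (diag_mx (map_mx conjC z) - diag_mx z).
  rewrite -linearB/= -linearZ/=; congr diag_mx; apply/rowP => j.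
  by rewrite !mxE -bE ImE mulrAC.
rewrite -scalemxAr -scalemxAl mulmxBr mulmxBl -ZE -ZsE' ZsE /Z.
have -> : A - 'i *: D - (A + 'i *: D) = - (2 * 'i) *: D.
  by rewrite opprD addrACA subrr add0r -scaleNr -scalerDl; congr (_ *: _); ring.
rewrite scalerA (_ : _ * _ = 1) ?scale1r// mulrN mulrA divfK ?pnatr_eq0//.
by rewrite -expr2 sqrCi opprK.
Qed.

(** Commutation gives a common eigenbasis, but with eigenvalues [x] and [y] in unrelated orders.
    Optimality of the trace is used a second time, to see that one reordering sorts both. *)
Lemma eigs_trace_simul n (A D : 'M[C]_n) a d : noninc a -> noninc d ->
  eigs A a -> eigs D d -> \tr (A *m D) = r2c (\sum_i a i * d i) ->
  exists2 U, U \is unitarymx &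
    A = U^t* *m rdiag a *m U /\ D = U^t* *m rdiag d *m U.
Proof.
move=> ad dd eA eD trE.
have [U [x [y [uU AE DE]]]] :=
  herm_comm_eigs (eigs_herm eA) (eigs_herm eD) (eigs_trace_comm ad dd eA eD trE).
have eAx : eigs A x by exists U.
have eDy : eigs D y by exists U.
have [s xs] := noninc_perm x; have [t yt] := noninc_perm y.
have aE i : a i = x (s i) := eigs_uniq ad xs eA (eigs_perm s eAx) i.
have dE i : d i = y (t i) := eigs_uniq dd yt eD (eigs_perm t eDy) i.
have sumE : \sum_i x i * y i = \sum_i a i * d i.
  by apply: (fmorph_inj r2c); rewrite -trE AE DE mxtrace_eigs.
(* The sorted lists are matched by the permutation matrix [s i == t j], which pairs positions that
   refer to the same eigenvector; it is optimal, so [x] and [y] are similarly ordered. *)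
have sup i j : 0 <= (x i - x j) * (y i - y j).
  have := @rearrangement_support _ _ a d (fun i j => (s i == t j)%:R : R) ad dd.
  have dl (f : 'I_n -> R) k : \sum_j (k == t j)%:R * f j = f (t^-1 k)%g.
    rewrite (bigD1 (t^-1 k)%g)//= permKV eqxx mul1r big1 ?addr0// => l jk.
    by rewrite -(inj_eq (@perm_inj _ t^-1%g)) permK eq_sym (negbTE jk) mul0r.
  have dr (f : 'I_n -> R) k : \sum_j (s j == k)%:R * f j = f (s^-1 k)%g.
    rewrite (bigD1 (s^-1 k)%g)//= permKV eqxx mul1r big1 ?addr0// => l jk.
    by rewrite -(inj_eq (@perm_inj _ s^-1%g)) permK (negbTE jk) mul0r.
  move=> /(_ (fun _ _ => ler0n _ _)).
  move=> /(_ (fun i => etrans (eq_bigr _ (fun j _ => esym (mulr1 _))) (dl (fun=> 1) _))).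
  move=> /(_ (fun i => etrans (eq_bigr _ (fun j _ => esym (mulr1 _))) (dr (fun=> 1) _))).
  have sE : \sum_i \sum_j (s i == t j)%:R * (a i * d j) = \sum_i a i * d i.
    under eq_bigr do rewrite dl dE permKV aE.
    by rewrite -sumE [RHS](reindex_inj (@perm_inj _ s)).
  move=> /(_ sE (s^-1 i)%g (t^-1 i)%g (s^-1 j)%g (t^-1 j)%g).
  by rewrite !aE !dE !permKV !eqxx oner_eq0; apply.
(* For similarly ordered lists, sorting the sum sorts each of them, ties included. *)
have [r rd] := noninc_perm (fun i => x i + y i).
have xr : noninc (x \o r).
  move=> i j /rd/=; have := sup (r i) (r j).
  move: (x (r i)) (x (r j)) (y (r i)) (y (r j)) => a1 a2 b1 b2 h1 h2.
  rewrite leNgt; apply/negP => h3.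
  by move: h1; rewrite nmulr_rge0 ?subr_lt0//; lra.
have yr : noninc (y \o r).
  move=> i j /rd/=; have := sup (r i) (r j).
  move: (x (r i)) (x (r j)) (y (r i)) (y (r j)) => a1 a2 b1 b2 h1 h2.
  rewrite leNgt; apply/negP => h3.
  by move: h1; rewrite nmulr_lge0 ?subr_lt0//; lra.
pose V := row_perm r U.
have uV : V \is unitarymx by exact: row_perm_unitarymx.
have VE z : U^t* *m rdiag z *m U = V^t* *m rdiag (z \o r) *m V.
  by rewrite row_perm_rdiag.
have ax : a =1 x \o r by apply: (eigs_uniq ad xr eA); exists V => //; rewrite AE.
have dy : d =1 y \o r by apply: (eigs_uniq dd yr eD); exists V => //; rewrite DE.
by exists V; rewrite // AE DE !VE; move/funext: ax => ->; move/funext: dy => ->.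
Qed.

(** * Inverses, singular value decomposition and positive definite matrices *)

Lemma mulmx1_invmx n (A B : 'M[C]_n) : A *m B = 1%:M -> invmx A = B.
Proof.
by move=> AB; have [uA _] := mulmx1_unit AB; rewrite -[LHS]mulmx1 -AB mulKmx.
Qed.

Lemma unitarymx_diag_mul n (U : 'M[C]_n) x y : U \is unitarymx ->
  (U^t* *m rdiag x *m U) *m (U^t* *m rdiag y *m U) =
  U^t* *m rdiag (fun i => x i * y i) *m U.
Proof.
move=> uU; rewrite !mulmxA mulmxtVK//; congr (_ *m _).
rewrite -mulmxA; congr (_ *m _); apply/matrixP => i j.
by rewrite mul_diag_mx !mxE rmorphM mulrnAr.
Qed.

Lemma rdiag1 n : rdiag (fun _ : 'I_n => 1) = 1%:M.
Proof.
by apply/matrixP => i j; rewrite !mxE rmorph1.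
Qed.

Lemma invmx_unitary_diag n (U : 'M[C]_n) x : U \is unitarymx ->
  (forall i, 0 < x i) ->
  invmx (U^t* *m rdiag x *m U) = U^t* *m rdiag (fun i => (x i)^-1) *m U.
Proof.
move=> uU x0; apply: mulmx1_invmx; rewrite unitarymx_diag_mul//.
rewrite (_ : (fun i => _) = (fun=> 1)).
  by rewrite rdiag1 mulmx1 trmxC_unitary_mul.
by apply/funext => i; rewrite mulfV// gt_eqF.
Qed.

Lemma eigs_invmx n (M : 'M[C]_n) x : (forall i, 0 < x i) -> eigs M x ->
  eigs (invmx M) (fun i => (x i)^-1).
Proof. by move=> x0 [U uU ->]; exists U; rewrite // invmx_unitary_diag. Qed.

Definition rev_perm n : 'S_n := perm (@rev_ord_inj n).

Lemma rev_permE n (i : 'I_n) : rev_perm n i = rev_ord i.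
Proof. by rewrite permE. Qed.

Lemma noninc_inv_rev n (x : 'I_n -> R) : (forall i, 0 < x i) -> noninc x ->
  noninc (fun i => (x (rev_ord i))^-1).
Proof.
move=> x0 xd i j ij; rewrite lef_pV2 ?posrE//; apply: xd => /=.
by rewrite leq_sub2l// ltnS.
Qed.

Lemma eigs_invmx_rev n (M : 'M[C]_n) x : (forall i, 0 < x i) -> eigs M x ->
  eigs (invmx M) (fun i => (x (rev_ord i))^-1).
Proof.
move=> x0 /(eigs_invmx x0)/(eigs_perm (rev_perm n)).
by congr eigs; apply/funext => i /=; rewrite rev_permE.
Qed.

Lemma sqrtC_r2c_gt0 x : 0 < x -> 0 < sqrtC (r2c x).
Proof. by rewrite sqrtC_gt0 -(rmorph0 r2c) (leW_mono r2c_le). Qed.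

Lemma conj_sqrtC_r2c x : 0 <= x -> (sqrtC (r2c x))^* = sqrtC (r2c x).
Proof. by move=> x0; apply: geC0_conj; rewrite sqrtC_ge0 -(rmorph0 r2c) r2c_le. Qed.

(** The right factor [U] is prescribed: in [dual_eigs] it must be the unitary that also diagonalises
    the frame operator. *)
Lemma eigs_svd n (N U : 'M[C]_n) x : (forall i, 0 < x i) -> U \is unitarymx ->
  N^t* *m N = U^t* *m rdiag x *m U ->
  exists2 W, W \is unitarymx &
    N = W^t* *m diag_mx (\row_j sqrtC (r2c (x j))) *m U.
Proof.
move=> x0 uU NE; have UU := trmxC_unitary_mul uU.
have c0 j : 0 < sqrtC (r2c (x j)) by exact: sqrtC_r2c_gt0.
pose c := diag_mx (\row_j sqrtC (r2c (x j))).
pose c' := diag_mx (\row_j (sqrtC (r2c (x j)))^-1).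
have cc' : c *m c' = 1%:M.
  apply/matrixP => i j; rewrite mul_diag_mx !mxE mulrnAr mulfV//.
  by rewrite gt_eqF.
have c'h : c'^t* = c'.
  rewrite tr_diag_mx map_diag_mx; congr diag_mx; apply/rowP => j; rewrite !mxE.
  by apply/CrealP; rewrite realV gtr0_real.
have c'x : c' *m rdiag x *m c' = 1%:M.
  apply/matrixP => i j; rewrite mul_mx_diag mul_diag_mx !mxE.
  have [->|ij] := eqVneq i j; last by rewrite !mulr0n mulr0 mul0r.
  by rewrite !mulr1n -{2}[r2c (x j)]sqrtCK expr2 mulKf ?mulfV// gt_eqF.
have c'c : c' *m c = 1%:M by apply: mulmx1C.
(* This is the required factorisation solved for [W]. *)
exists (c' *m U *m N^t*); last first.
  rewrite trmxC_mul trmxCK (trmxC_mul c') c'h.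
  by rewrite -!mulmxA (mulmxA c') c'c mul1mx UU mulmx1.
apply/unitarymxP; rewrite trmxC_mul trmxCK (trmxC_mul c') c'h.
by rewrite (mulmxA _ N) -(mulmxA _ _ N) NE !mulmxA !mulmxtVK.
Qed.

(** The singular values in the definition of the angles give the spectrum of [N *m N^t*], on V;
    principal vectors live in W, where [N^t* *m N] acts. *)
Lemma eigs_trmxC_mul n (N : 'M[C]_n) x : (forall i, 0 < x i) ->
  eigs (N *m N^t*) x -> eigs (N^t* *m N) x.
Proof.
move=> x0 [U uU NE]; have := @eigs_svd _ (N^t*) U x x0 uU.
rewrite trmxCK => /(_ NE)[W uW NW]; exists W => //.
pose c := diag_mx (\row_j sqrtC (r2c (x j))).
have NE' : N = U^t* *m c^t* *m W.
  by rewrite -[LHS]trmxCK NW trmxC_mul (trmxC_mul (W^t*)) trmxCK mulmxA.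
rewrite NW NE' !mulmxA mulmxtVK//; congr (_ *m _); rewrite -mulmxA; congr (_ *m _).
apply/matrixP => i j; rewrite tr_diag_mx map_diag_mx mul_diag_mx !mxE.
rewrite mulrnAr /= conj_sqrtC_r2c ?ltW//.
by rewrite -expr2 sqrtCK.
Qed.

Lemma posdef_eigs_gt0 n (M : 'M[C]_n) x : eigs M x ->
  (forall v : 'rV[C]_n, v != 0 -> 0 < (v *m M *m v^t*) 0 0) -> forall i, 0 < x i.
Proof.
move=> [U uU ME] M0 i; rewrite -(leW_mono r2c_le) rmorph0.
have vU : row i U *m U^t* = delta_mx 0 i.
  by rewrite -row_mul (unitarymxP uU) row1.
have -> : r2c (x i) = (row i U *m M *m (row i U)^t*) 0 0.
  rewrite (eigs_qform _ ME) vU (bigD1 i)//= big1 => [|j ji].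
    by rewrite mxE !eqxx normr1 expr1n mulr1 addr0.
  by rewrite mxE (negbTE ji) andbF normr0 expr0n mulr0.
apply: M0; apply/eqP => Ui; move: vU; rewrite Ui mul0mx => /rowP/(_ i).
by rewrite !mxE !eqxx => /eqP; rewrite eq_sym oner_eq0.
Qed.

(** Inverse square roots of the eigenvalues rescale a unitary diagonalisation; applied to a Gram
    matrix, [P] orthonormalises the basis. *)
Lemma posdef_congr1 n (M : 'M[C]_n) : M^t* = M ->
  (forall v : 'rV[C]_n, v != 0 -> 0 < (v *m M *m v^t*) 0 0) ->
  exists2 P, P \in unitmx & P *m M *m P^t* = 1%:M.
Proof.
move=> hM M0; have [x Mx] := herm_eigs hM.
have x0 := posdef_eigs_gt0 Mx M0; have [U uU ME] := Mx.
have c0 j : 0 < sqrtC (r2c (x j)) by exact: sqrtC_r2c_gt0.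
pose c := diag_mx (\row_j (sqrtC (r2c (x j)))^-1).
have ch : c^t* = c.
  rewrite tr_diag_mx map_diag_mx; congr diag_mx; apply/rowP => j; rewrite !mxE.
  by apply/CrealP; rewrite realV gtr0_real.
have P1 : c *m U *m M *m (c *m U)^t* = 1%:M.
  rewrite ME trmxC_mul ch !mulmxA !mulmxtVK//.
  apply/matrixP => i j; rewrite mul_mx_diag mul_diag_mx !mxE.
  have [->|ij] := eqVneq i j; last by rewrite !mulr0n mulr0 mul0r.
  by rewrite !mulr1n -{2}[r2c (x j)]sqrtCK expr2 mulKf ?mulfV// gt_eqF.
exists (c *m U) => //.
by have [] := mulmx1_unit (etrans (mulmxA _ _ _) P1).
Qed.

(** * Oblique duality for matrices: product bounds and equality cases *)

Section ObliqueDual.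
Context (n : nat) (N S M : 'M[C]_n) (l s v : 'I_n -> R).
Context (N_unit : N \in unitmx).
Context (M_def : M = (invmx N)^t* *m invmx S *m invmx N).
Context (l_noninc : noninc l) (s_noninc : noninc s) (v_noninc : noninc v).
Context (l_gt0 : forall i, 0 < l i) (s_gt0 : forall i, 0 < s i).
Context (v_gt0 : forall i, 0 < v i).
Context (eigs_S : eigs S l) (eigs_NN : eigs (N *m N^t*) s) (eigs_M : eigs M v).

(** An arbitrary [J] is allowed because [mu] is sorted: its first entries come from scattered
    indices. *)
Lemma dual_prod_ge (J : {set 'I_n}) :
  \prod_(i in J) (l (rev_ord i))^-1 <=
  \prod_(i in J) s i * \prod_(i < n | (i < #|J|)%N) v i.
Proof.
apply: (@eigs_prod_le _ (N^t*) M v s) => //.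
- exact: noninc_inv_rev.
- by move=> i; rewrite invr_ge0 ltW.
- by rewrite trmxCK; apply: eigs_trmxC_mul.
have -> : N^t* *m M *m N^t*^t* = invmx S.
  rewrite trmxCK M_def !mulmxA -trmxC_mul mulVmx// trmx1 map_mx1 mul1mx.
  by rewrite mulmxKV.
exact: eigs_invmx_rev.
Qed.

Lemma dual_prod_le k : (k <= n)%N ->
  \prod_(i < n | (i < k)%N) v i <=
  \prod_(i < n | (i < k)%N) ((s (rev_ord i))^-1 * (l (rev_ord i))^-1).
Proof.
move=> kn; pose J : {set 'I_n} := finset (fun i : 'I_n => (i < k)%N).
have cJ : #|J| = k by rewrite cardsE card_ord_lt.
have pJ (f : 'I_n -> R) : \prod_(i in J) f i = \prod_(i < n | (i < k)%N) f i.
  by apply: eq_bigl => i; rewrite inE.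
have := @eigs_prod_le _ ((invmx N)^t*) (invmx S) _ _ v J
  (noninc_inv_rev l_gt0 l_noninc) (noninc_inv_rev s_gt0 s_noninc) v_noninc.
rewrite !pJ cJ big_split/=; apply; rewrite ?trmxCK -?M_def//.
- by move=> i; rewrite invr_gt0.
- by move=> i; rewrite invr_gt0.
- by move=> i; rewrite ltW.
- exact: eigs_invmx_rev.
rewrite (_ : _ *m _ = invmx (N *m N^t*)); first exact: eigs_invmx_rev.
symmetry; apply: mulmx1_invmx; rewrite mulmxA -(mulmxA N) -trmxC_mul mulVmx//.
by rewrite trmx1 map_mx1 mulmx1 mulmxV.
Qed.

Lemma mxtrace_dual : \tr (invmx S *m invmx (N^t* *m N)) = r2c (\sum_i v i).
Proof.
have -> : invmx (N^t* *m N) = invmx N *m (invmx N)^t*.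
  apply: mulmx1_invmx; rewrite mulmxA mulmxK//.
  by rewrite -trmxC_mul mulVmx// trmx1 map_mx1.
rewrite mulmxA mxtrace_mulC mulmxA -M_def; have [U uU ->] := eigs_M.
rewrite -mulmxA mxtrace_mulC mulmxtVK// rmorph_sum.
by apply: eq_bigr => i _; rewrite !mxE eqxx mulr1n.
Qed.

(** The trace is minimal here, so the maximal case is applied to the negative of
    [invmx (N^t* *m N)], whose eigenvalues [- (s i)^-1] are non-increasing. *)
Lemma dual_simul_lower :
  \sum_i v i = \sum_i (l (rev_ord i))^-1 * (s i)^-1 ->
  exists2 U, U \is unitarymx &
    S = U^t* *m rdiag (fun i => l (rev_ord i)) *m U /\
    N^t* *m N = U^t* *m rdiag s *m U.
Proof.
move=> sE.
have eN := eigs_invmx s_gt0 (eigs_trmxC_mul s_gt0 eigs_NN).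
have := @eigs_trace_simul _ (invmx S) (r2c (-1) *: invmx (N^t* *m N))
  _ (fun i => -1 * (s i)^-1) (noninc_inv_rev l_gt0 l_noninc) _ (eigs_invmx_rev l_gt0 eigs_S) (eigs_scale (-1) eN).
case.
- by move=> i j ij; rewrite !mulN1r lerN2 lef_pV2 ?posrE// s_noninc.
- rewrite -scalemxAr linearZ/= mxtrace_dual -rmorphM sE mulr_sumr.
  by congr (r2c _); apply: eq_bigr => i _; ring.
move=> U uU [SE NE]; exists U => //; split.
  rewrite -[LHS]invmxK SE invmx_unitary_diag// => [|i]; last by rewrite invr_gt0.
  by congr (_ *m rdiag _ *m _); apply/funext => i; rewrite invrK.
rewrite -[LHS]invmxK (_ : invmx (N^t* *m N) = U^t* *m rdiag (fun i => (s i)^-1) *m U).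
  rewrite invmx_unitary_diag// => [|i]; last by rewrite invr_gt0.
  by congr (_ *m rdiag _ *m _); apply/funext => i; rewrite invrK.
move/(congr1 (fun X => r2c (-1) *: X)): NE.
rewrite scalerA -rmorphM mulrNN mulr1 rmorph1 scale1r => ->.
rewrite scalemxAl scalemxAr; congr (_ *m _ *m _); apply/matrixP => i j.
by rewrite !mxE mulrnAr -rmorphM mulrA mulrNN !mul1r.
Qed.

(** Both inverses are sorted by reversing the indices, so the trace is maximal; the reversal is
    undone on the rows of [U]. *)
Lemma dual_simul_upper :
  \sum_i v i = \sum_i (l i)^-1 * (s i)^-1 ->
  exists2 U, U \is unitarymx &
    S = U^t* *m rdiag l *m U /\ N^t* *m N = U^t* *m rdiag s *m U.
Proof.
move=> sE; have eN := eigs_trmxC_mul s_gt0 eigs_NN.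
have := @eigs_trace_simul _ (invmx S) (invmx (N^t* *m N)) _ _
  (noninc_inv_rev l_gt0 l_noninc) (noninc_inv_rev s_gt0 s_noninc)
  (eigs_invmx_rev l_gt0 eigs_S) (eigs_invmx_rev s_gt0 eN).
rewrite mxtrace_dual sE; case.
  by congr (r2c _); apply: reindex_inj; apply: rev_ord_inj.
move=> U uU [SE NE]; exists (row_perm (rev_perm n) U); first exact: row_perm_unitarymx.
have E (A : 'M[C]_n) (x : 'I_n -> R) : (forall i, 0 < x i) ->
    invmx A = U^t* *m rdiag (fun i => (x (rev_ord i))^-1) *m U ->
    A = (row_perm (rev_perm n) U)^t* *m rdiag x *m row_perm (rev_perm n) U.
  move=> x0 AE; rewrite -[LHS]invmxK AE invmx_unitary_diag// => [|i].
    2: by rewrite invr_gt0.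
  rewrite -(row_perm_rdiag _ (rev_perm n)); congr (_ *m rdiag _ *m _).
  by apply/funext => i; rewrite /= invrK rev_permE rev_ordK.
by split; apply: E.
Qed.

(** In the singular value decomposition of [N] along [U] the unitary [U] cancels from [M]. Since [a]
    may be in any order, this serves the converse of both equality cases. *)
Lemma dual_eigs U a : U \is unitarymx -> (forall i, 0 < a i) ->
  S = U^t* *m rdiag a *m U -> N^t* *m N = U^t* *m rdiag s *m U ->
  eigs M (fun i => (a i)^-1 * (s i)^-1).
Proof.
move=> uU a0 SE NE; have [W uW NW] := eigs_svd s_gt0 uU NE.
set c := diag_mx _ in NW.
pose c' := diag_mx (\row_j (sqrtC (r2c (s j)))^-1).
have c0 j : 0 < sqrtC (r2c (s j)) by exact: sqrtC_r2c_gt0.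
have cc' : c *m c' = 1%:M.
  apply/matrixP => i j; rewrite mul_diag_mx !mxE mulrnAr mulfV//.
  by rewrite gt_eqF.
have iN : invmx N = U^t* *m c' *m W.
  apply: mulmx1_invmx; rewrite NW !mulmxA mulmxtVK// -(mulmxA _ c) cc' mulmx1.
  exact: trmxC_unitary_mul.
exists W => //.
rewrite M_def iN SE invmx_unitary_diag// trmxC_mul (trmxC_mul (U^t*)) trmxCK.
rewrite !mulmxA !mulmxtVK//; congr (_ *m _); rewrite -!mulmxA; congr (_ *m _).
apply/matrixP => i j; rewrite tr_diag_mx map_diag_mx !mul_diag_mx !mxE.
rewrite mulrnAr mulrnAr; congr (_ *+ _).
rewrite /= fmorphV /= conj_sqrtC_r2c ?ltW// mulrCA -invfM -expr2 sqrtCK rmorphM !fmorphV//.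
Qed.

End ObliqueDual.

End Spectrum.

(** * Finite-rank operators in coordinates *)

Section HilbertCoordinates.
Local Open Scope sesquilinear_scope.
Context {R : realType} {H : hilbertType R}.
Local Notation C := R[i].
Local Notation r2c := (real_complex R : {rmorphism R -> C}).
Local Notation eigs := (@eigs R C r2c _).
Local Notation span := Defs.span.
Local Notation eigenspace := Defs.eigenspace.

Lemma real_complex_le : {mono r2c : x y / x <= y}.
Proof. by move=> x y; exact: lecR. Qed.

Lemma real_complex_real (z : C) : z \is Num.real -> exists x, z = r2c x.
Proof. by move=> zr; exists (complex.Re z); rewrite [RHS]RRe_real. Qed.

Lemma hdotDl (x y z : H) : '[x + y, z] = '[x, z] + '[y, z].
Proof. exact: linearDl. Qed.

Lemma hdotBl (x y z : H) : '[x - y, z] = '[x, z] - '[y, z].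
Proof. exact: linearBl. Qed.

Lemma hdotZl (a : C) (x z : H) : '[a *: x, z] = a * '[x, z].
Proof. exact: linearZl_LR. Qed.

Lemma hdot_suml n (F : 'I_n -> H) z : '[\sum_i F i, z] = \sum_i '[F i, z].
Proof. exact: linear_sumlz. Qed.

Lemma hdot0l (z : H) : '[0, z] = 0.
Proof. exact: linear0l. Qed.

Lemma hdot0r (z : H) : '[z, 0] = 0.
Proof. by rewrite hdotC hdot0l conjC0. Qed.

Lemma hdotBr (x y z : H) : '[z, x - y] = '[z, x] - '[z, y].
Proof. by rewrite (hdotC z (x - y)) (hdotC z x) (hdotC z y) hdotBl rmorphB. Qed.

Lemma hdot_ge0 (x : H) : 0 <= '[x, x].
Proof. by rewrite hdotE exprn_ge0. Qed.

Lemma hdot_eq0 (x : H) : '[x, x] = 0 -> x = 0.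
Proof. by move/eqP; rewrite hdotE expf_eq0/= normr_eq0 => /eqP. Qed.

Lemma hdot_inj (x y : H) : (forall z, '[z, x] = '[z, y]) -> x = y.
Proof.
move=> xy; apply/eqP; rewrite -subr_eq0; apply/eqP/hdot_eq0.
by rewrite hdotBr xy subrr.
Qed.

Definition onsys n (g : 'I_n -> H) := forall i j, '[g i, g j] = (i == j)%:R.

Lemma synthesisD n (F : 'I_n -> H) a b :
  synthesis F (a + b) = synthesis F a + synthesis F b.
Proof.
by rewrite /synthesis -big_split; apply: eq_bigr => i _; rewrite mxE scalerDl.
Qed.

Lemma synthesisZ n (F : 'I_n -> H) c a : synthesis F (c *: a) = c *: synthesis F a.
Proof.
by rewrite /synthesis scaler_sumr; apply: eq_bigr => i _; rewrite mxE scalerA.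
Qed.

Lemma synthesisB n (F : 'I_n -> H) a b :
  synthesis F (a - b) = synthesis F a - synthesis F b.
Proof. by rewrite synthesisD -scaleN1r synthesisZ scaleN1r. Qed.

Lemma synthesis0 n (F : 'I_n -> H) : synthesis F 0 = 0.
Proof. by rewrite -(scale0r 0) synthesisZ scale0r. Qed.

Lemma analysisD n (F : 'I_n -> H) x y :
  analysis F (x + y) = analysis F x + analysis F y.
Proof. by apply/rowP => i; rewrite !mxE hdotDl. Qed.

Lemma analysisB n (F : 'I_n -> H) x y :
  analysis F (x - y) = analysis F x - analysis F y.
Proof. by apply/rowP => i; rewrite !mxE hdotBl. Qed.

Lemma analysisZ n (F : 'I_n -> H) c x : analysis F (c *: x) = c *: analysis F x.
Proof. by apply/rowP => i; rewrite !mxE hdotZl. Qed.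

Lemma synthesis_mul m n (e : 'I_n -> H) (P : 'M[C]_(m, n)) a :
  synthesis (fun i => synthesis e (row i P)) a = synthesis e (a *m P).
Proof.
rewrite /synthesis; under eq_bigr do rewrite scaler_sumr.
rewrite exchange_big; apply: eq_bigr => j _; rewrite mxE scaler_suml.
by apply: eq_bigr => i _; rewrite mxE scalerA.
Qed.

Lemma hdot_synthesisl n (e : 'I_n -> H) a x :
  '[synthesis e a, x] = \sum_i a 0 i * '[e i, x].
Proof. by rewrite hdot_suml; apply: eq_bigr => i _; rewrite hdotZl. Qed.

Lemma hdot_synthesis n (e : 'I_n -> H) a x :
  '[synthesis e a, x] = (a *m (analysis e x)^t*) 0 0.
Proof.
rewrite hdot_synthesisl mxE; apply: eq_bigr => i _; rewrite !mxE.
by congr (_ * _); exact: hdotC.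
Qed.

Lemma analysis_mul m n (e : 'I_n -> H) (P : 'M[C]_(m, n)) x :
  analysis (fun i => synthesis e (row i P)) x = analysis e x *m P^t*.
Proof.
apply/rowP => i; rewrite mxE hdotC hdot_synthesis !mxE rmorph_sum.
apply: eq_bigr => j _; rewrite !mxE rmorphM mulrC; congr (_ * _).
by rewrite -[RHS]conjCK.
Qed.

Lemma analysis_synthesis m n (e : 'I_m -> H) (g : 'I_n -> H) a :
  analysis g (synthesis e a) = a *m \matrix_(i, j) '[e i, g j].
Proof.
apply/rowP => j; rewrite !mxE hdot_synthesisl.
by apply: eq_bigr => i _; rewrite mxE.
Qed.

Lemma onsys_gram n (g : 'I_n -> H) : onsys g -> \matrix_(i, j) '[g i, g j] = 1%:M.
Proof. by move=> og; apply/matrixP => i j; rewrite !mxE og. Qed.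

Lemma synthesisK n (g : 'I_n -> H) : onsys g -> cancel (synthesis g) (analysis g).
Proof. by move=> og a; rewrite analysis_synthesis onsys_gram// mulmx1. Qed.

Lemma onsys_lin_indep n (g : 'I_n -> H) : onsys g -> lin_indep g.
Proof. by move=> og a; rewrite -(synthesis0 g) => /(can_inj (synthesisK og)). Qed.

Lemma synthesis_delta n (F : 'I_n -> H) i : synthesis F (delta_mx 0 i) = F i.
Proof.
rewrite /synthesis (bigD1 i)//= mxE !eqxx scale1r big1 ?addr0// => j ji.
by rewrite mxE (negbTE ji) andbF scale0r.
Qed.

Lemma span_self n (F : 'I_n -> H) i : span F (F i).
Proof. by exists (delta_mx 0 i); rewrite ?synthesis_delta. Qed.

Lemma span_synthesis n (e : 'I_n -> H) a : span e (synthesis e a).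
Proof. by exists a. Qed.

Lemma analysisK n (g : 'I_n -> H) x :
  onsys g -> span g x -> synthesis g (analysis g x) = x.
Proof. by move=> og [a _ <-]; rewrite synthesisK. Qed.

Lemma orthocP n (g : 'I_n -> H) x : orthoc (span g) x <-> analysis g x = 0.
Proof.
split=> [xg|xg _ [a _ <-]].
  by apply/rowP => i; rewrite !mxE; apply: xg; exact: span_self.
by rewrite hdotC hdot_synthesis xg trmx0 map_mx0 mulmx0 mxE conjC0.
Qed.

Lemma orth_projE n (g : 'I_n -> H) x : onsys g ->
  orth_proj (span g) x = synthesis g (analysis g x).
Proof.
move=> og; apply: xget_unique => [|y [[a _ <-] /orthocP]].
  split; first exact: span_synthesis.
  by apply/orthocP; rewrite analysisB synthesisK// subrr.
by rewrite analysisB synthesisK// => /eqP; rewrite subr_eq0 => /eqP ->.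
Qed.

Lemma span_mul n (e : 'I_n -> H) (P : 'M[C]_n) : P \in unitmx ->
  span (fun i => synthesis e (row i P)) = span e.
Proof.
move=> uP; apply/seteqP; split=> _ [a _ <-].
  by rewrite synthesis_mul; exact: span_synthesis.
by exists (a *m invmx P) => //; rewrite synthesis_mul mulmxKV.
Qed.

Lemma onsys_mul n (g : 'I_n -> H) (U : 'M[C]_n) : onsys g -> U \is unitarymx ->
  onsys (fun i => synthesis g (row i U)).
Proof.
move=> og /unitarymxP uU i j; rewrite hdot_synthesis synthesisK//.
move/matrixP/(_ i j): uU; rewrite !mxE => <-.
by apply: eq_bigr => k _; rewrite !mxE.
Qed.

Lemma hdot_synthesis_gram m n (e : 'I_m -> H) (g : 'I_n -> H) a b :
  '[synthesis e a, synthesis g b] = (a *m (\matrix_(i, j) '[e i, g j]) *m b^t*) 0 0.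
Proof.
have <- : (\matrix_(i, j) '[g i, e j])^t* = \matrix_(i, j) '[e i, g j].
  by apply/matrixP => i j; rewrite !mxE; symmetry; exact: hdotC.
by rewrite hdot_synthesis analysis_synthesis trmxC_mul mulmxA.
Qed.

(** Independence makes the Gram matrix positive definite, and a congruence taking it to the identity
    is the change of basis. *)
Lemma gram_schmidt (V : set H) d : has_dim V d ->
  exists2 g : 'I_d -> H, onsys g & span g = V.
Proof.
move=> [e ei <-]; pose G := \matrix_(i, j) '[e i, e j].
have hG : G^t* = G by apply/matrixP => i j; rewrite !mxE; symmetry; exact: hdotC.
have [|P uP PGP] := posdef_congr1 real_complex_le real_complex_real hG.
  move=> v v0; rewrite -hdot_synthesis_gram lt_neqAle hdot_ge0 andbT eq_sym.
  by apply/eqP => /hdot_eq0 /ei /eqP; rewrite (negbTE v0).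
exists (fun i => synthesis e (row i P)); last exact: span_mul.
move=> i j; rewrite hdot_synthesis_gram -!row_mul.
move/matrixP/(_ i j): PGP; rewrite !mxE => <-.
by apply: eq_bigr => k _; rewrite !mxE.
Qed.

Lemma lin_indep_dim_le m n (e : 'I_m -> H) (g : 'I_n -> H) :
  lin_indep e -> span e = span g -> (m <= n)%N.
Proof.
move=> ei eg.
have ge i : exists b, synthesis e b = g i.
  suff [b _ be] : span e (g i) by exists b.
  by rewrite eg; exact: span_self.
have eE i : exists b, synthesis g b = e i.
  suff [b _ be] : span g (e i) by exists b.
  by rewrite -eg; exact: span_self.
have [P PE] := choice eE; have [Q QE] := choice ge.
pose P' := \matrix_i P i; pose Q' := \matrix_i Q i.
have P'E : (fun i => synthesis g (row i P')) = e by apply/funext => i; rewrite rowK.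
have Q'E : (fun i => synthesis e (row i Q')) = g by apply/funext => i; rewrite rowK.
apply: (@mulmx1_min _ _ _ P' Q'); apply/row_matrixP => i; apply/eqP.
rewrite -subr_eq0; apply/eqP/ei; rewrite synthesisB !rowE mulmxA mulmx1.
by rewrite -synthesis_mul Q'E -synthesis_mul P'E subrr.
Qed.

Lemma has_dim_uniq (V : set H) m n : has_dim V m -> has_dim V n -> m = n.
Proof.
move=> [e ei eV] [g gi gV]; apply/eqP; rewrite eqn_leq.
by rewrite (lin_indep_dim_le ei (g := g)) ?(lin_indep_dim_le gi (g := e)) ?eV ?gV.
Qed.

(* [M] acts on rows of coordinates, so composition reverses matrix products. *)
Definition mxop n (g : 'I_n -> H) (M : 'M[C]_n) : H -> H :=
  fun x => synthesis g (analysis g x *m M).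

Lemma mxop_comp n (g : 'I_n -> H) M M' : onsys g ->
  mxop g M \o mxop g M' = mxop g (M' *m M).
Proof. by move=> og; apply/funext => x; rewrite /mxop /= synthesisK// mulmxA. Qed.

Lemma mxop_conj n (g : 'I_n -> H) (U M : 'M[C]_n) :
  mxop (fun i => synthesis g (row i U)) M = mxop g (U^t* *m M *m U).
Proof. by apply/funext => x; rewrite /mxop synthesis_mul analysis_mul !mulmxA. Qed.

Lemma mxopD n (g : 'I_n -> H) M x y : mxop g M (x + y) = mxop g M x + mxop g M y.
Proof. by rewrite /mxop analysisD mulmxDl synthesisD. Qed.

Lemma mxopZ n (g : 'I_n -> H) M c x : mxop g M (c *: x) = c *: mxop g M x.
Proof. by rewrite /mxop analysisZ -scalemxAl synthesisZ. Qed.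

Lemma mxop0 n (g : 'I_n -> H) M : mxop g M 0 = 0.
Proof. by have := mxopZ g M 0 0; rewrite !scale0r. Qed.

Lemma mxop_sum m n (g : 'I_n -> H) M (F : 'I_m -> H) :
  mxop g M (\sum_i F i) = \sum_i mxop g M (F i).
Proof.
exact: (big_morph _ (mxopD g M) (mxop0 g M)).
Qed.

Lemma mxop_inj n (g : 'I_n -> H) M M' : onsys g -> mxop g M = mxop g M' -> M = M'.
Proof.
move=> og MM'; apply/row_matrixP => i; rewrite !rowE.
have := congr1 (fun f => analysis g (f (synthesis g (delta_mx 0 i)))) MM'.
by rewrite /mxop !synthesisK.
Qed.

Lemma mxop_rdiag n (g : 'I_n -> H) x f :
  mxop g (rdiag r2c x) f = \sum_j (x j)%:C *: tensor (g j) f.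
Proof.
apply: eq_bigr => j _; rewrite mul_mx_rdiag mxE /tensor scalerA.
by congr (_ *: _); rewrite mulrC.
Qed.

Lemma frame_op_synthesis m n (g : 'I_n -> H) (P : 'M[C]_(m, n)) :
  frame_op (fun i => synthesis g (row i P)) = mxop g (P^t* *m P).
Proof.
by apply/funext => x; rewrite /frame_op /= synthesis_mul analysis_mul -mulmxA.
Qed.

(** As [g] need not span [H], the operator has a further kernel; [0 < t] keeps it out of the
    eigenspace. *)
Lemma dim_eigenspace n (g : 'I_n -> H) x t m : onsys g -> 0 < t ->
  has_dim (eigenspace (mxop g (rdiag r2c x)) t) m -> m = #|[pred j | x j == t]|.
Proof.
move=> og t0 dm; apply: (has_dim_uniq dm).
set J := [pred j | x j == t].
have tn0 : (t%:C : C) != 0 by rewrite (fmorph_eq0 r2c) gt_eqF.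
exists (fun i : 'I_#|J| => g (enum_val i)).
  by apply: onsys_lin_indep => i j; rewrite og (inj_eq enum_val_inj).
apply/seteqP; split=> [_ [a _ <-]|f].
  rewrite /eigenspace /=.
  rewrite /synthesis mxop_sum scaler_sumr.
  apply: eq_bigr => i _; rewrite mxopZ scalerA mulrC -scalerA; congr (_ *: _).
  have /eqP <- : x (enum_val i) == t by have := enum_valP i; rewrite inE.
  set k := enum_val i; rewrite mxop_rdiag (bigD1 k)//= big1 ?addr0.
    by rewrite /tensor og eqxx scale1r.
  by move=> j jk; rewrite /tensor og eq_sym (negbTE jk) scale0r scaler0.
rewrite /eigenspace /= => Tf.
have xa j : j \notin J -> '[f, g j] = 0.
  rewrite inE => xj.
  have := congr1 (fun y => analysis g y 0 j) Tf.
  rewrite /mxop synthesisK// analysisZ mul_mx_rdiag !mxE mulrC => /eqP.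
  rewrite -subr_eq0 -mulrBl mulf_eq0 subr_eq0 => /orP[/eqP/(fmorph_inj r2c)/eqP|/eqP//].
  by rewrite (negbTE xj).
exists (\row_i '[f, g (enum_val i)]) => //.
(* Since [t] is nonzero, [f] is a multiple of its image and so a combination of the [g j]. *)
apply: (scalerI tn0); rewrite -Tf mxop_rdiag (bigID (mem J))/= [X in _ + X]big1 ?addr0.
  rewrite big_enum_val scaler_sumr; apply: eq_bigr => i _.
  have /eqP -> : x (enum_val i) == t by have := enum_valP i; rewrite inE.
  by rewrite mxE.
by move=> j /xa fj; rewrite /tensor fj scale0r scaler0.
Qed.

(** * From eigenvalue lists on [H] to spectra of matrices *)

Lemma card_seq_nat (s : seq nat) : uniq s -> ([set` s] #= `I_(size s))%card.
Proof.
move=> us; have -> : [set` s] = [set` [fset i in s]%fset].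
  by apply/seteqP; split=> i /=; rewrite !inE.
by apply/card_eq_fsetP; rewrite card_fseq undup_id.
Qed.

Lemma level_size_le (l : nat -> R) t m (s : seq nat) : uniq s ->
  (forall i, i \in s -> l i = t) -> ([set i | l i = t] #= `I_m)%card ->
  (size s <= m)%N.
Proof.
move=> us st cm; rewrite -card_le_II -(card_le_eql (card_seq_nat us)).
by rewrite -(card_le_eqr cm); apply: subset_card_le => i /st.
Qed.

Lemma level_size_eq (l : nat -> R) t m (s : seq nat) : uniq s ->
  (forall i, i \in s <-> l i = t) -> ([set i | l i = t] #= `I_m)%card ->
  size s = m.
Proof.
move=> us st cm; apply/card_eq_II; rewrite -(card_eql (card_seq_nat us)).
rewrite -(card_eqr cm) (_ : [set` s] = [set i | l i = t]) ?card_eqxx//.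
by apply/seteqP; split=> i /= /st.
Qed.

Lemma count_ord n (x : 'I_n -> R) t :
  count_mem t [seq x j | j <- enum 'I_n] = #|[pred j | x j == t]|.
Proof.
rewrite count_map -sum1_count big_enum_cond -sum1_card.
by apply: eq_bigl => j; rewrite !inE.
Qed.

(** The multiplicities are known only at positive levels of an infinite list; the count [n] of the
    positive [x j] bounds how many entries of [l] are positive. *)
Lemma positive_levels_perm n (x : 'I_n -> R) (l : nat -> R) :
  (forall j, 0 < x j) -> nonincreasing_seq l -> (forall i, 0 <= l i) ->
  (forall t, 0 < t -> ([set i | l i = t] #= `I_#|[pred j | x j == t]|)%card) ->
  exists s : 'S_n, forall i : 'I_n, l i = x (s i).
Proof.
move=> x0 ld l0 lx; pose xs := [seq x j | j <- enum 'I_n].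
have szx : size xs = n by rewrite size_map size_enum_ord.
pose L N := [seq l i | i <- iota 0 N].
have LE N t : count_mem t (L N) = size [seq i <- iota 0 N | l i == t].
  by rewrite count_map size_filter; apply: eq_count => i.
(* A positive initial stretch of [l] is a sub-multiset of [xs], hence no longer than it. *)
have LN N : (forall i, (i < N)%N -> 0 < l i) -> (N <= n)%N.
  move=> l0N; rewrite -(size_iota 0 N) -(size_map l) -szx.
  have /count_subseqP[s sx ps] : forall t, (count_mem t (L N) <= count_mem t xs)%N.
    move=> t; rewrite count_ord LE; have [t0|t0] := ltP 0 t; last first.
      rewrite (@eq_in_filter _ _ pred0) ?filter_pred0// => i.
      rewrite mem_iota /= add0n => /l0N li; apply/negbTE.
      by rewrite gt_eqF// (le_lt_trans t0).
    apply: (@level_size_le l t) (lx t t0); first by rewrite filter_uniq// iota_uniq.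
    by move=> i; rewrite mem_filter => /andP[/eqP].
  by rewrite (perm_size ps) size_subseq.
have lN i : (n <= i)%N -> l i = 0.
  move=> ni; apply/eqP; rewrite eq_le l0 andbT leNgt; apply/negP => li.
  have /LN : forall k, (k < n.+1)%N -> 0 < l k.
    by move=> k kn; apply: (lt_le_trans li); apply: ld; rewrite (leq_trans _ ni).
  by rewrite ltnn.
have cL t : 0 < t -> count_mem t (L n) = count_mem t xs.
  move=> t0; rewrite count_ord LE; apply: (@level_size_eq l t) (lx t t0).
    by rewrite filter_uniq// iota_uniq.
  move=> i; rewrite mem_filter mem_iota /= add0n; split=> [/andP[/eqP]//|lit].
  rewrite lit eqxx /= ltnNge; apply/negP => /lN; rewrite lit => t00.
  by rewrite t00 ltxx in t0.
(* Zeros among the first [n] entries are excluded by size: [xs] is a sub-multiset of [L n] and both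
   have [n] elements. *)
have /count_subseqP[s sL ps] : forall t, (count_mem t xs <= count_mem t (L n))%N.
  move=> t; have [t0|t0] := ltP 0 t; first by rewrite cL.
  rewrite count_ord (@eq_card0 _ _)// => j; rewrite !inE; apply/negbTE.
  by rewrite gt_eqF// (le_lt_trans t0).
have szL : size (L n) = n by rewrite size_map size_iota.
have sE : s = L n.
  by apply/eqP; rewrite -(size_subseq_leqif sL) szL -(perm_size ps) szx.
have LE' : L n = [seq l (i : 'I_n) | i <- enum 'I_n].
  by rewrite /L -val_enum_ord -map_comp.
move: ps; rewrite sE LE' perm_sym => ps.
have /tuple_permP[p pE] : perm_eq [tuple l (i : 'I_n) | i < n] [tuple x i | i < n].
  exact: ps.
exists p => i.
have := congr1 (fun s => nth 0 s i) pE.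
by rewrite -!tnth_nth !tnth_mktuple.
Qed.

Lemma eigenvalue_list_op n (g : 'I_n -> H) M x l : onsys g ->
  eigs M x -> (forall i, 0 < x i) -> eigenvalue_list (mxop g M) l ->
  (forall i : 'I_n, 0 < l i) /\ eigs M (fun i : 'I_n => l i).
Proof.
move=> og Mx x0 [ld l0 lt].
have [U uU ME] := Mx.
have opE : mxop g M = mxop (fun i => synthesis g (row i U)) (rdiag r2c x).
  by rewrite mxop_conj -ME.
have oU := onsys_mul og uU.
have [|s sE] := positive_levels_perm x0 ld l0.
  move=> t t0; have [m dm cm] := lt t t0.
  by rewrite opE in dm; rewrite -(dim_eigenspace oU t0 dm).
split=> [i|]; first by rewrite sE.
have -> : (fun i : 'I_n => l i) = x \o s by apply/funext => i; rewrite sE.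
exact: eigs_perm.
Qed.

(** * Adjoint and absolute value *)

Lemma adjointE (T S : H -> H) : (forall x y, '[T x, y] = '[x, S y]) -> adjoint T = S.
Proof.
move=> TS; apply: xget_unique => // S' TS'; apply/funext => y.
by apply: hdot_inj => z; rewrite -TS -TS'.
Qed.

Lemma self_adjoint_op n (g : 'I_n -> H) M : M^t* = M -> self_adjoint (mxop g M).
Proof.
move=> hM x y; rewrite /mxop hdot_synthesis (hdotC x) hdot_synthesis.
by rewrite conjC_form hM.
Qed.

Lemma positive_op_rdiag n (g : 'I_n -> H) (x : 'I_n -> R) : (forall i, 0 <= x i) ->
  positive_op (mxop g (rdiag r2c x)).
Proof.
move=> x0; split=> [c u v|u]; first by rewrite mxopD mxopZ.
rewrite mxop_rdiag hdot_suml; apply: sumr_ge0 => j _.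
rewrite hdotZl /tensor hdotZl (hdotC (g j)) -normCK.
by rewrite mulr_ge0 ?exprn_ge0// lecR.
Qed.

(** One explicit positive root, with square roots on the diagonal, makes [xget] return an operator
    with the defining properties. *)
Lemma abs_opP n (g : 'I_n -> H) M x (T : H -> H) : onsys g -> eigs M x ->
  (forall i, 0 <= x i) -> adjoint T \o T = mxop g M ->
  positive_op (abs_op T) /\ abs_op T \o abs_op T = mxop g M.
Proof.
move=> og [U uU ME] x0 TE; rewrite -{1}TE.
apply: (@xgetPex _ (fun=> 0)
  [set S : H -> H | positive_op S /\ S \o S = adjoint T \o T]).
exists (mxop (fun i => synthesis g (row i U)) (rdiag r2c (fun i => Num.sqrt (x i)))).
split; first by apply: positive_op_rdiag => i; rewrite sqrtr_ge0.
rewrite mxop_comp; last exact: onsys_mul.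
rewrite TE ME -mxop_conj; congr mxop; apply/matrixP => i j.
rewrite mul_rdiag !mxE mulrnAr -rmorphM.
by rewrite -expr2 sqr_sqrtr.
Qed.

(** The vector [y = S x - c x] satisfies [S y = - c y], which positivity of [S] allows only for
    [y = 0]. Thus eigenvectors of |T| are read off its square. *)
Lemma positive_sqrt_eigen (S : H -> H) (c : R) (x : H) : positive_op S -> 0 < c ->
  (S (S x) = (c ^+ 2)%:C *: x) <-> (S x = c%:C *: x).
Proof.
move=> [linS S0] c0.
have Sz : S 0 = 0 by have := linS (-1) 0 0; rewrite scaler0 addr0 scaleN1r addNr.
have SZ a u : S (a *: u) = a *: S u.
  by have := linS a u 0; rewrite Sz !addr0.
have SB u v : S (u - v) = S u - S v.
  by have := linS (-1) v u; rewrite !scaleN1r ![- _ + _]addrC.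
split=> [SSx|Sx]; last by rewrite Sx SZ Sx scalerA -rmorphM.
pose y := S x - c%:C *: x; apply/eqP; rewrite -subr_eq0 -/y; apply/eqP/hdot_eq0.
have Sy : S y = - (c%:C *: y).
  rewrite /y SB SSx SZ scalerBr opprB scalerA -rmorphM.
  by rewrite addrC.
have := S0 y; rewrite Sy -scaleNr hdotZl nmulr_rge0 ?oppr_lt0 ?ltcR// => y0.
by apply/eqP; rewrite eq_le y0 hdot_ge0.
Qed.

Lemma eigenvalue_list_abs (T : H -> H) l : positive_op (abs_op T) ->
  singular_values T l ->
  eigenvalue_list (abs_op T \o abs_op T) (fun i => l i ^+ 2).
Proof.
move=> pT [ld l0 lt]; split=> [i j ij|i|t t0].
- by rewrite lerXn2r// ?nnegrE// ld.
- by rewrite exprn_ge0.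
have s0 : 0 < Num.sqrt t by rewrite sqrtr_gt0.
have [m dm cm] := lt _ s0; exists m.
  have -> : eigenspace (abs_op T \o abs_op T) t =
    eigenspace (abs_op T) (Num.sqrt t); last by [].
  apply/seteqP; split=> x; rewrite /eigenspace/=.
    by rewrite -{1}(sqr_sqrtr (ltW t0)) => /(positive_sqrt_eigen _ pT s0).
  by move=> /(positive_sqrt_eigen _ pT s0); rewrite sqr_sqrtr// ltW.
have -> : [set i | l i ^+ 2 = t] = [set i | l i = Num.sqrt t]; last by [].
apply/seteqP; split=> i /= => [<-|->]; first by rewrite sqrtr_sqr ger0_norm.
by rewrite sqr_sqrtr// ltW.
Qed.

End HilbertCoordinates.

(** * Oblique duality *)

Section ObliqueDuality.
Local Open Scope sesquilinear_scope.
Context {R : realType} {H : hilbertType R}.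
Local Notation C := R[i].
Local Notation r2c := (real_complex R : {rmorphism R -> C}).
Local Notation eigs := (@eigs R C r2c _).
Local Notation span := Defs.span.
Local Notation eigenspace := Defs.eigenspace.
Local Notation pinv := Defs.pinv.

(** For orthonormal bases [g] of V and [e] of W this is the matrix of the orthogonal projection onto
    W restricted to V; with a frame as first argument, its rows are the coordinates of the frame
    vectors. *)
Definition cross_gram m n (g : 'I_m -> H) (e : 'I_n -> H) : 'M[C]_(m, n) :=
  \matrix_(i, j) '[g i, e j].

Lemma cross_gram_trmxC m n (g : 'I_m -> H) (e : 'I_n -> H) :
  (cross_gram g e)^t* = cross_gram e g.
Proof. by apply/matrixP => i j; rewrite !mxE; symmetry; exact: hdotC. Qed.

Lemma orth_proj_comp m n (g : 'I_m -> H) (e : 'I_n -> H) x : onsys g -> onsys e ->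
  (orth_proj (span e) \o orth_proj (span g)) x =
  synthesis e (analysis g x *m cross_gram g e).
Proof.
move=> og oe.
by rewrite /= (orth_projE _ og) (orth_projE _ oe) analysis_synthesis.
Qed.

Lemma adjoint_orth_proj_comp m n (g : 'I_m -> H) (e : 'I_n -> H) :
  onsys g -> onsys e ->
  adjoint (orth_proj (span e) \o orth_proj (span g)) =
  orth_proj (span g) \o orth_proj (span e).
Proof.
move=> og oe; apply: adjointE => x y; rewrite !orth_proj_comp//.
rewrite hdot_synthesis (hdotC x) hdot_synthesis.
by rewrite conjC_form (cross_gram_trmxC e g).
Qed.

Lemma orth_proj_comp_normal n (g e : 'I_n -> H) : onsys g -> onsys e ->
  let T := orth_proj (span e) \o orth_proj (span g) in
  adjoint T \o T = mxop g (cross_gram g e *m (cross_gram g e)^t*).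
Proof.
move=> og oe T; rewrite adjoint_orth_proj_comp//; apply/funext => x.
transitivity ((orth_proj (span g) \o orth_proj (span e)) (T x)); first by [].
rewrite (orth_proj_comp (T x) oe og) /T (orth_proj_comp x og oe) (synthesisK oe).
by rewrite (cross_gram_trmxC g e) /mxop mulmxA.
Qed.

(** A row in the kernel consists of the coordinates of a vector of V orthogonal to W. *)
Lemma cross_gram_unit n (g e : 'I_n -> H) : onsys g ->
  direct_sum (span g) (orthoc (span e)) -> cross_gram g e \in unitmx.
Proof.
move=> og [_ ge]; rewrite unitmxE unitfE; apply/negP => /det0P[v v0 vN].
have : (span g `&` orthoc (span e)) (synthesis g v).
  split; first exact: span_synthesis.
  by apply/orthocP; rewrite analysis_synthesis.
by rewrite ge => /(onsys_lin_indep og) /eqP; rewrite (negbTE v0).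
Qed.

Lemma proj_along_synthesis n (g e : 'I_n -> H) a : onsys g -> onsys e ->
  cross_gram g e \in unitmx ->
  proj_along (span g) (orthoc (span e)) (synthesis e a) =
  synthesis g (a *m invmx (cross_gram g e)).
Proof.
move=> og oe uN; apply: xget_unique => [|y [[b _ <-] /orthocP]].
  split; first exact: span_synthesis.
  apply/orthocP; rewrite analysisB synthesisK// analysis_synthesis mulmxKV//.
  exact: subrr.
rewrite analysisB synthesisK// analysis_synthesis => /eqP.
by rewrite subr_eq0 => /eqP ->; rewrite mulmxK.
Qed.

Lemma pinv_op n (e : 'I_n -> H) S a : onsys e -> S \in unitmx -> S^t* = S ->
  pinv (mxop e S) (synthesis e a) = synthesis e (a *m invmx S).
Proof.
move=> oe uS hS; set T := mxop e S; set X := pinv T.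
have [TXT XTX _ sXT] : [/\ T \o X \o T = T, X \o T \o X = X,
    self_adjoint (T \o X) & self_adjoint (X \o T)].
  apply: (@xgetPex _ (fun=> 0) [set X : H -> H | [/\ T \o X \o T = T,
    X \o T \o X = X, self_adjoint (T \o X) & self_adjoint (X \o T)]]).
  pose X0 := mxop e (invmx S).
  have TX : T \o X0 = mxop e 1%:M by rewrite /T /X0 (mxop_comp S (invmx S) oe) mulVmx.
  have XT : X0 \o T = mxop e 1%:M by rewrite /T /X0 (mxop_comp (invmx S) S oe) mulmxV.
  have sI : self_adjoint (mxop e 1%:M).
    by apply: self_adjoint_op; rewrite trmx1 map_mx1.
  exists X0; rewrite /= TX XT; split=> //.
    by rewrite /T (mxop_comp 1%:M S oe) mulmx1.
  by rewrite /X0 (mxop_comp 1%:M (invmx S) oe) mulmx1.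
pose y := synthesis e (a *m invmx S); pose z := X (T y).
have Ty : T y = synthesis e a by rewrite /T /mxop synthesisK// mulmxKV.
have Tz : T z = T y by exact: (congr1 (fun f => f y) TXT).
(* [X (T 0)] is not known to vanish; self-adjointness, used once in each direction, moves the zero
   vector to the other side. *)
have zperp u : analysis e u = 0 -> '[z, u] = 0.
  move=> eu; rewrite -[z]/((X \o T) y) sXT /=.
  have -> : T u = T 0 by rewrite [RHS]mxop0 /T /mxop eu mul0mx synthesis0.
  by rewrite -[X (T 0)]/((X \o T) 0) -sXT hdot0r.
have zE : z = synthesis e (analysis e z).
  apply/eqP; rewrite -subr_eq0; apply/eqP/hdot_eq0.
  set u := z - _; have eu : analysis e u = 0 by rewrite analysisB synthesisK// subrr.
  by rewrite {1}/u hdotBl zperp// hdot_synthesis eu trmx0 map_mx0 mulmx0 mxE subrr.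
rewrite -Ty -/z zE; congr synthesis.
have := congr1 (analysis e) Tz; rewrite Ty /T /mxop !synthesisK// => <-.
by rewrite mulmxK.
Qed.

Section Frame.
Context (d n : nat) (g e : 'I_d -> H) (F : 'I_n -> H).
Context (og : onsys g) (oe : onsys e).
Context (ge : direct_sum (span g) (orthoc (span e))).
Context (HF : is_frame (span e) F).

Local Notation N := (cross_gram g e).
Local Notation Phi := (cross_gram F e).
Local Notation S := (Phi^t* *m Phi).
Local Notation M := ((invmx N)^t* *m invmx S *m invmx N).

Lemma frame_coord k : F k = synthesis e (row k Phi).
Proof.
have -> : row k Phi = analysis e (F k) by apply/rowP => j; rewrite !mxE.
by rewrite analysisK// -HF; exact: span_self.
Qed.

Lemma frame_op_coord : frame_op F = mxop e S.
Proof. by rewrite -frame_op_synthesis; congr frame_op; apply/funext/frame_coord. Qed.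

Lemma frame_row_neq0 (v : 'rV[C]_d) : v != 0 -> v *m Phi^t* != 0.
Proof.
apply: contra => /eqP vP.
have : orthoc (span F) (synthesis e v).
  by apply/orthocP; rewrite analysis_synthesis -[\matrix_(_, _) _](cross_gram_trmxC F e).
rewrite HF => /(_ _ (span_synthesis e v)) /hdot_eq0 /(onsys_lin_indep oe) ->.
exact: eqxx.
Qed.

Lemma frame_unit : S \in unitmx.
Proof. exact: gram_unitmx frame_row_neq0. Qed.

Lemma frame_posdef (v : 'rV[C]_d) : v != 0 -> 0 < (v *m S *m v^t*) 0 0.
Proof.
move=> /frame_row_neq0; rewrite (gramC_congr v Phi).
exact: mulmx_trmxC_gt0.
Qed.

Lemma frame_op_dual :
  frame_op (canonical_dual (span g) (span e) F) = mxop g M.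
Proof.
have uN := cross_gram_unit og ge.
rewrite -(dual_gram N frame_unit).
rewrite -frame_op_synthesis; congr frame_op; apply/funext => k.
rewrite /canonical_dual frame_op_coord [F k]frame_coord.
rewrite (pinv_op _ oe frame_unit (trmxC_gram Phi)).
by rewrite (proj_along_synthesis _ og oe uN) !row_mul.
Qed.

Lemma dual_posdef (v : 'rV[C]_d) : v != 0 -> 0 < (v *m M *m v^t*) 0 0.
Proof.
exact: dual_gram_posdef frame_row_neq0 (cross_gram_unit og ge).
Qed.

Lemma dual_herm : M^t* = M.
Proof. by rewrite -(dual_gram N frame_unit) trmxC_gram. Qed.

Lemma cross_gram_posdef (v : 'rV[C]_d) : v != 0 -> 0 < (v *m (N *m N^t*) *m v^t*) 0 0.
Proof.
move=> v0; rewrite (gram_congr v N); apply: mulmx_trmxC_gt0.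
exact: unitmx_row_neq0 (cross_gram_unit og ge) v0.
Qed.

Lemma eigenvalue_list_posdef (h : 'I_d -> H) (A : 'M[C]_d) l : onsys h ->
  A^t* = A -> (forall v : 'rV[C]_d, v != 0 -> 0 < (v *m A *m v^t*) 0 0) ->
  eigenvalue_list (mxop h A) l ->
  (forall i : 'I_d, 0 < l i) /\ eigs A (fun i : 'I_d => l i).
Proof.
move=> oh hA A0; have [x Ax] := herm_eigs real_complex_real hA.
have x0 := posdef_eigs_gt0 real_complex_le Ax A0.
exact: eigenvalue_list_op oh Ax x0.
Qed.

(** Invertibility of [N] makes the first [d] singular values positive, which is where every angle
    gets a positive cosine. *)
Lemma singular_values_eigs l :
  singular_values (orth_proj (span e) \o orth_proj (span g)) l ->
  (forall i : 'I_d, 0 < l i) /\ eigs (N *m N^t*) (fun i : 'I_d => l i ^+ 2).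
Proof.
move=> sl; have hN : (N *m N^t*)^t* = N *m N^t* by rewrite trmxC_mul trmxCK.
have [x Nx] := herm_eigs real_complex_real hN.
have x0 := posdef_eigs_gt0 real_complex_le Nx cross_gram_posdef.
have [|pT TT] := abs_opP og Nx _ (orth_proj_comp_normal og oe).
  by move=> i; apply: ltW.
have := eigenvalue_list_abs pT sl; rewrite TT.
move=> /(eigenvalue_list_posdef og hN cross_gram_posdef)[l0 Nl]; split=> // i.
have [_ li _] := sl; rewrite lt_neqAle li andbT eq_sym.
by have := l0 i; apply: contraTN => /eqP ->; rewrite expr0n ltxx.
Qed.

(** The rows of [U] are the coordinates of the [w j] in [e]. On W the absolute value has square
    [N^t* *m N], so being principal means diagonalising that matrix; [a] covers both orderings in
    the theorem. *)
Lemma principal_vectorsP (theta : 'I_d -> R) (a : 'I_d -> R) :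
  (forall j, 0 < cos (theta j)) ->
  eigs (N *m N^t*) (fun j => cos (theta j) ^+ 2) ->
  (exists2 U, U \is unitarymx &
    S = U^t* *m rdiag r2c a *m U /\
    N^t* *m N = U^t* *m rdiag r2c (fun j => cos (theta j) ^+ 2) *m U) <->
  (exists2 w : 'I_d -> H, principal_vectors (span g) (span e) theta w &
    forall f, frame_op F f = \sum_(j < d) (a j)%:C *: tensor (w j) f).
Proof.
move=> c0 Ns; set s := fun j => _ in Ns *.
have s0 j : 0 < s j by rewrite exprn_gt0.
have NNs := eigs_trmxC_mul real_complex_le s0 Ns.
have [|pT TT] := abs_opP oe (T := orth_proj (span g) \o orth_proj (span e)) NNs
  (fun i => ltW (s0 i)).
  by have := orth_proj_comp_normal oe og; rewrite -(cross_gram_trmxC g e) (trmxCK N).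
have absE x j : (abs_op (orth_proj (span g) \o orth_proj (span e)) x =
    (cos (theta j))%:C *: x) <-> (mxop e (N^t* *m N) x = (s j)%:C *: x).
  by rewrite -TT /=; split=> /(positive_sqrt_eigen _ pT (c0 j)).
split=> [[U uU [SE NE]]|[w [[ow we] wabs] wS]].
  pose w i := synthesis e (row i U); have ow := onsys_mul oe uU.
  exists w.
    split; first by split; [exact: ow|apply: span_mul; exact: unitarymx_unit].
    move=> j; apply/absE; rewrite NE -mxop_conj mxop_rdiag (bigD1 j)//= big1 ?addr0.
      by rewrite /tensor (ow j j) eqxx scale1r.
    by move=> i ij; rewrite /tensor (ow j i) eq_sym (negbTE ij) scale0r scaler0.
  by move=> f; rewrite frame_op_coord SE -mxop_conj mxop_rdiag.
pose U := cross_gram w e.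
have wU : (fun i => synthesis e (row i U)) = w.
  apply/funext => i; have -> : row i U = analysis e (w i) by apply/rowP => j; rewrite !mxE.
  by apply: analysisK => //; rewrite -we; exact: span_self.
have uU : U \is unitarymx.
  apply/unitarymxP/matrixP => i j; rewrite [RHS]mxE -(ow i j).
  have wi k : w k = synthesis e (row k U) by rewrite -[in LHS]wU.
  rewrite [in RHS]wi [in RHS](wi j) hdot_synthesis synthesisK// !mxE.
  by apply: eq_bigr => k _; rewrite !mxE.
exists U => //; split.
  apply: (mxop_inj oe); rewrite -frame_op_coord -mxop_conj wU; apply/funext => f.
  by rewrite wS mxop_rdiag.
apply: (unitarymx_intertwine uU); apply/matrixP => j k; rewrite mul_rdiag.
have /absE := wabs j; rewrite -wU.
move=> /(congr1 (fun x => analysis e x 0 k)).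
by rewrite /mxop synthesisK// -synthesisZ !synthesisK// -row_mul !mxE.
Qed.

End Frame.

End ObliqueDuality.

Theorem theorem4p3 (R : realType) (H : hilbertType R) (Hsep : separable H)
    (d : nat) (V W : set H) (dimV : has_dim V d) (dimW : has_dim W d)
    (VW : direct_sum V (orthoc W))
    (theta : 'I_d -> R) (Htheta : principal_angles V W theta)
    (n : nat) (F : 'I_n -> H) (HF : is_frame W F)
    (lam lamV : nat -> R)
    (Hlam : eigenvalue_list (frame_op F) lam)
    (HlamV : eigenvalue_list (frame_op (canonical_dual V W F)) lamV)
    (mu : seq R)
    (Hmu : mu = nonincr_rearr
       [seq (lam (rev_ord j))^-1 * cos (theta j) ^- 2 | j <- enum 'I_d]) :
  [/\ forall k : nat, (0 < k <= d)%N ->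
        \prod_(j < d | (j < k)%N) mu`_j <= \prod_(j < d | (j < k)%N) lamV j
          <= (\prod_(j < d | (d - k <= j)%N) (lam j * cos (theta j) ^+ 2))^-1,
      (forall j : 'I_d, lamV j = mu`_j) <->
        (exists2 w : 'I_d -> H, principal_vectors V W theta w &
           forall f, frame_op F f =
             \sum_(j < d) (lam (rev_ord j))%:C *: tensor (w j) f) &
      (forall j : 'I_d,
         lamV j = (lam (rev_ord j))^-1 * cos (theta (rev_ord j)) ^- 2) <->
        (exists2 w : 'I_d -> H, principal_vectors V W theta w &
           forall f, frame_op F f =
             \sum_(j < d) (lam j)%:C *: tensor (w j) f)].
Proof.
have [g og gV] := gram_schmidt dimV; have [e oe eW] := gram_schmidt dimW.
subst V W.
pose r2c : {rmorphism R -> R[i]} := real_complex R.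
pose N := cross_gram g e; pose Phi := cross_gram F e.
pose S := map_mx conjC Phi^T *m Phi.
pose M := map_mx conjC (invmx N)^T *m invmx S *m invmx N.
have uN : N \in unitmx := cross_gram_unit og VW.
have [_ _ sv] := Htheta.
pose s (j : 'I_d) := cos (theta j) ^+ 2.
have [c0 eN] : (forall j, 0 < cos (theta j)) /\ eigs r2c (N *m map_mx conjC N^T) s.
  have [l0 Nl] := singular_values_eigs og oe VW sv.
  split=> [j|]; first by have := l0 j; rewrite valK.
  suff -> : s = fun i : 'I_d =>
    (if insub (val i) is Some j then cos (theta j) else 0) ^+ 2 by [].
  by apply/funext => j; rewrite valK.
have s0 j : 0 < s j by rewrite exprn_gt0.
have sd : noninc s.
  have [ld _ _] := sv; move=> i j ij; rewrite lerXn2r ?nnegrE ?(ltW (c0 _))//.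
  by have := ld i j ij; rewrite !valK.
have [l0 eS] : (forall i : 'I_d, 0 < lam i) /\ eigs r2c S (fun i : 'I_d => lam i).
  apply: (eigenvalue_list_posdef oe (trmxC_gram Phi) (frame_posdef oe HF)).
  by rewrite -(frame_op_coord oe HF).
have [v0 eM] : (forall i : 'I_d, 0 < lamV i) /\ eigs r2c M (fun i : 'I_d => lamV i).
  apply: (eigenvalue_list_posdef og (dual_herm g oe HF) (dual_posdef og oe VW HF)).
  by rewrite -(frame_op_dual og oe VW HF).
have ld : noninc (fun i : 'I_d => lam i) by have [h _ _] := Hlam => i j; exact: h.
have vd : noninc (fun i : 'I_d => lamV i) by have [h _ _] := HlamV => i j; exact: h.
pose a (j : 'I_d) := (lam (rev_ord j))^-1 * (s j)^-1.
have [p ap muE] : exists2 p : 'S_d, noninc (a \o p) & forall j : 'I_d, mu`_j = a (p j).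
  by rewrite Hmu; exact: sort_ge_perm.
split.
- move=> k /andP[k0 kd]; apply/andP; split.
    (* [J] holds the indices of the [k] largest entries of [a], so the product of the first [k]
       entries of [mu] runs over [J]. *)
    pose J := p @: finset (fun i : 'I_d => (i < k)%N).
    have cJ : #|J| = k by rewrite (card_imset _ (@perm_inj _ p)) cardsE (card_ord_lt kd).
    have JE (f : 'I_d -> R) : \prod_(j < d | (j < k)%N) f (p j) = \prod_(j in J) f j.
      rewrite [RHS]big_imset => [|i j _ _]; last exact: perm_inj.
      by apply: eq_bigl => i; rewrite inE.
    have := dual_prod_ge real_complex_le real_complex_real
      uN (erefl M) ld sd vd l0 s0 v0 eS eN eM J.
    rewrite cJ => h; rewrite [leLHS](eq_bigr _ (fun j _ => muE j)).
    rewrite JE big_split/= [X in _ * X <= _]prodfV ler_pdivrMr 1?mulrC//.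
    exact: prodr_gt0.
  have h := dual_prod_le real_complex_le real_complex_real
      uN (erefl M) ld sd vd l0 s0 v0 eS eN eM kd.
  (* Reversing the indices turns the last [k] positions into the first [k]; the two bounds then
     coincide. *)
  apply: le_trans h _; rewrite -prodfV [leRHS](reindex_inj rev_ord_inj)/= le_eqVlt.
  apply/orP; left; apply/eqP; apply: eq_big => [j|j _]; last first.
    by rewrite [RHS]invfM mulrC.
  by have := ltn_ord j; lia.
- apply: (iff_trans _ (principal_vectorsP og oe HF (fun j => lam (rev_ord j)) c0 eN)).
  split=> [vE|[U uU [SE NE]]].
    apply: (dual_simul_lower real_complex_le real_complex_real
      uN (erefl M) ld sd l0 s0 eS eN eM).
    rewrite (eq_bigr _ (fun j _ => vE j)) (eq_bigr _ (fun j _ => muE j)).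
    by rewrite [RHS](reindex_inj (@perm_inj _ p)).
  have := dual_eigs real_complex_le (erefl M) s0 uU (fun j => l0 (rev_ord j)) SE NE.
  move=> /(eigs_perm p) /(eigs_uniq real_complex_le vd ap eM) vE j.
  by rewrite muE; exact: vE.
- apply: (iff_trans _ (principal_vectorsP og oe HF (fun j : 'I_d => lam j) c0 eN)).
  have revE (f : 'I_d -> R) : \sum_j f j = \sum_j f (rev_ord j).
    by rewrite (reindex_inj rev_ord_inj).
  split=> [vE|[U uU [SE NE]]].
    apply: (dual_simul_upper real_complex_le real_complex_real
      uN (erefl M) ld sd l0 s0 eS eN eM).
    by rewrite (eq_bigr _ (fun j _ => vE j)) [RHS]revE.
  have := dual_eigs real_complex_le (erefl M) s0 uU l0 SE NE.
  move=> /(eigs_perm (rev_perm d)) eM' j.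
  (* Uniqueness needs the reversed list to be non-increasing, as a product of two positive
     non-increasing lists. *)
  rewrite (eigs_uniq real_complex_le vd _ eM eM' j) /= ?rev_permE// => i1 i2 i12.
  rewrite /= !rev_permE; apply: ler_pM; rewrite ?invr_ge0 ?(ltW (l0 _)) ?(ltW (s0 _))//.
    exact: noninc_inv_rev ld _ _ i12.
  exact: noninc_inv_rev sd _ _ i12.
Qed.
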